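(* Let $\Lambda$ be a locally convex, row-finite $k$-graph, let $\tilde\Lambda$ be the desourcification of $\Lambda$, and let $R$ be a commutative ring with $1$. Then there is a surjective Morita context between $\mathrm{KP}_R(\tilde\Lambda)$ and $\mathrm{KP}_R(\Lambda)$.
   Context: $\mathbb N=\{0,1,2,\dots\}$, $k\geq 1$ is an integer, $e_1,\dots,e_k$ is the standard basis of $\mathbb N^k$, $\leq$ is coordinatewise and $\wedge$ is the coordinatewise minimum. A $k$-graph is a countable category $\Lambda$ with a functor $d:\Lambda\to\mathbb N^k$ (degree) satisfying the factorisation property: if $d(\lambda)=m+n$ with $m,n\in\mathbb N^k$, there are unique $\mu,\nu\in\Lambda$ with $d(\mu)=m$, $d(\nu)=n$, $\lambda=\mu\nu$. Morphisms are called paths; the set $\Lambda^0$ of objects (vertices) is identified with the set of paths of degree $0$; $r,s:\Lambda\to\Lambda^0$ are the codomain (range) and domain (source) maps, so $\lambda\mu$ is defined iff $s(\lambda)=r(\mu)$. Write $\Lambda^n=d^{-1}(n)$, $\Lambda^{\neq0}=\Lambda\setminus\Lambda^0$, $v\Lambda=\{\lambda:r(\lambda)=v\}$, $v\Lambda^n=v\Lambda\cap\Lambda^n$. $\Lambda$ is row-finite if every $v\Lambda^n$ is finite. $\Lambda$ is locally convex if for all $v\in\Lambda^0$, $i\neq j$, $\lambda\in v\Lambda^{e_i}$, $\mu\in v\Lambda^{e_j}$, the sets $s(\lambda)\Lambda^{e_j}$ and $s(\mu)\Lambda^{e_i}$ are nonempty. For $n\in\mathbb N^k$, $\Lambda^{\leq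 n}=\{\lambda\in\Lambda: d(\lambda)\leq n,\text{ and } d(\lambda)_i<n_i\text{ implies } s(\lambda)\Lambda^{e_i}=\emptyset\}$, and $v\Lambda^{\leq n}=v\Lambda\cap\Lambda^{\leq n}$. Boundary paths: for $m\in(\mathbb N\cup\{\infty\})^k$ let $\Omega_{k,m}$ be the $k$-graph with objects $\{p\in\mathbb N^k:p\leq m\}$, morphisms $(p,q)$ with $p\leq q\leq m$, $r(p,q)=p$, $s(p,q)=q$, $d(p,q)=q-p$. A boundary path of degree $m$ is a degree-preserving functor $x:\Omega_{k,m}\to\Lambda$ such that whenever $p\leq m$ and $p_i=m_i$ we have $x(p)\Lambda^{e_i}=\emptyset$, where $x(p):=x(p,p)$. Write $d(x)=m$, $r(x)=x(0)$; $\Lambda^{\leq\infty}$ is the set of boundary paths. For $n\leq d(x)$, $\sigma^n(x)$ is the boundary path $(p,q)\mapsto x(n+p,n+q)$ of degree $d(x)-n$. If $s(\lambda)=r(x)$, $\lambda x$ is the boundary path of degree $d(\lambda)+d(x)$ with $(\lambda x)(0,d(\lambda))=\lambda$ and $\sigma^{d(\lambda)}(\lambda x)=x$. Desourcification: on $\{(x;m):x\in\Lambda^{\leq\infty},m\in\mathbb N^k\}$ put $(x;m)\approx(y;p)$ iff $x(m\wedge d(x))=y(p\wedge d(y))$ and $m-m\wedge d(x)=p-p\wedge d(y)$. On $\{(x;(m,n)):x\in\Lambda^{\leq\infty},m\leq n\in\mathbb N^k\}$ put $(x;(m,n))\sim(y;(p,q))$ iff $x(m\wedge d(x),n\wedge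 d(x))=y(p\wedge d(y),q\wedge d(y))$, $m-m\wedge d(x)=p-p\wedge d(y)$ and $n-m=q-p$. These are equivalence relations with classes $[x;m]$, $[x;(m,n)]$. The desourcification $\tilde\Lambda$ is the $k$-graph with vertices $[x;m]$, paths $[x;(m,n)]$, $r([x;(m,n)])=[x;m]$, $s([x;(m,n)])=[x;n]$, identities $[x;(m,m)]$, degree $d([x;(m,n)])=n-m$, and composition $[x;(m,n)]\circ[y;(p,q)]=[x(0,n\wedge d(x))\,\sigma^{p\wedge d(y)}(y);(m,n+q-p)]$ when $[x;n]=[y;p]$. It is a well-defined row-finite $k$-graph without sources (all $v\tilde\Lambda^n\ne\emptyset$). Kumjian-Pask families (for a locally convex, row-finite $k$-graph $\Gamma$, e.g. $\Gamma=\Lambda$ or $\tilde\Lambda$): for each $\lambda\in\Gamma^{\neq 0}$ let $\lambda^*$ be a formal symbol; for $v\in\Gamma^0$ put $v^*=v$. $R$-algebras are associative but need not be unital. A Kumjian-Pask $\Gamma$-family $(P,S)$ in an $R$-algebra $A$ consists of elements $P_v$ ($v\in\Gamma^0$), $S_\lambda,S_{\lambda^*}$ ($\lambda\in\Gamma^{\neq0}$) of $A$ such that, with the convention $S_v=S_{v^*}=P_v$: (KP1) $P_vP_w=\delta_{v,w}P_v$; (KP2) $S_\lambda S_\mu=S_{\lambda\mu}$ and $S_{\mu^*}S_{\lambda^*}=S_{(\lambda\mu)^*}$ when $r(\mu)=s(\lambda)$, and $P_{r(\lambda)}S_\lambda=S_\lambda=S_\lambda P_{s(\lambda)}$, $P_{s(\lambda)}S_{\lambda^*}=S_{\lambda^*}=S_{\lambda^*}P_{r(\lambda)}$;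 (KP3$'$) $S_{\lambda^*}S_\mu=\delta_{\lambda,\mu}P_{s(\lambda)}$ for all $n\in\mathbb N^k\setminus\{0\}$ and $\lambda,\mu\in\Gamma^{\leq n}$; (KP4$'$) $P_v=\sum_{\lambda\in v\Gamma^{\leq n}}S_\lambda S_{\lambda^*}$ for all $v\in\Gamma^0$, $n\in\mathbb N^k\setminus\{0\}$. (If $\Gamma$ has no sources then $\Gamma^{\leq n}=\Gamma^n$.) $\mathrm{KP}_R(\Gamma)$ is the $R$-algebra generated by a universal Kumjian-Pask $\Gamma$-family. Morita context between rings $A$ and $B$ (not necessarily unital): an $A$--$B$ bimodule $M$, a $B$--$A$ bimodule $N$, and bimodule homomorphisms $\psi:M\otimes_BN\to A$, $\phi:N\otimes_AM\to B$ satisfying $n'\cdot\psi(m\otimes n)=\phi(n'\otimes m)\cdot n$ and $m'\cdot\phi(n\otimes m)=\psi(m'\otimes n)\cdot m$ for all $m,m'\in M$, $n,n'\in N$; it is surjective if $\psi$ and $\phi$ are surjective. *)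

(* Defs.v *)
From HB Require Import structures.
From mathcomp Require Import all_boot all_order all_algebra.
From mathcomp Require Import boolp classical_sets cardinality.
From mathcomp Require Import zify.

Set Implicit Arguments.
Unset Strict Implicit.
Unset Printing Implicit Defensive.

Import GRing.Theory.

Local Open Scope quotient_scope.
Local Open Scope ring_scope.
Local Open Scope classical_set_scope.

Notation mdeg k := {ffun 'I_k -> nat}.

(* Elements of $(\mathbb N\cup\{\infty\})^k$; [None] is $\infty$. *)
Notation edeg k := {ffun 'I_k -> option nat}.

Section Degrees.
Variable k : nat.
Implicit Types (m n p q : mdeg k) (e : edeg k).

Definition mle m n : bool := [forall i, (m i <= n i)%N].
(* Truncated subtraction. *)
Definition msub m n : mdeg k := [ffun i => (m i - n i)%N].
Definition unitm (i : 'I_k) : mdeg k := [ffun j => (j == i : nat)].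

Definition mlee m e : bool :=
  [forall i, if e i is Some a then (m i <= a)%N else true].
(* $m\wedge e\in\mathbb N^k$ *)
Definition mcap m e : mdeg k :=
  [ffun i => if e i is Some a then minn (m i) a else m i].
Definition eadd m e : edeg k := [ffun i => omap (addn (m i)) (e i)].
Definition esub e m : edeg k := [ffun i => omap (fun a => a - m i)%N (e i)].

Lemma mleP m n : reflect (forall i, m i <= n i)%N (mle m n).
Proof. exact: forallP. Qed.

Lemma mleeP m e :
  reflect (forall i, if e i is Some a then (m i <= a)%N else true) (mlee m e).
Proof. exact: forallP. Qed.

Lemma maddE m n i : (m + n) i = (m i + n i)%N.
Proof. by rewrite ffunE. Qed.

Lemma m0E i : (0 : mdeg k) i = 0%N.
Proof. by rewrite ffunE. Qed.

End Degrees.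

(* Reduces (in)equalities between degrees to linear arithmetic, coordinate by
   coordinate. *)
Ltac mdeg_hyps i :=
  repeat match goal with
  | H : is_true (_ && _) |- _ =>
      let H1 := fresh in let H2 := fresh in case/andP: (H) => H1 H2; clear H
  | H : is_true (mle ?m ?n) |- _ => generalize (elimT (mleP m n) H i); clear H
  | H : is_true (mlee ?m ?e) |- _ => generalize (elimT (mleeP m e) H i); clear H
  | H : @eq {ffun 'I_?k -> _} ?m ?n |- _ =>
      generalize (congr1 (fun f : {ffun 'I_k -> _} => f i) H); clear H
  end; cbn beta.
Ltac mdeg_solve :=
  match goal with |- is_true (_ && _) => apply/andP; split | _ => idtac end;
  match goal with
  | |- is_true (mle _ _) => apply/mleP
  | |- is_true (mlee _ _) => apply/mleeP
  | _ => apply/ffunP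
  end;
  let i := fresh "i" in
  move=> i; mdeg_hyps i; cbn [fst snd];
  rewrite ?(ffunE, m0E, maddE) /=;
  repeat match goal with
  | |- context [match ?e i with Some _ => _ | None => _ end] => destruct (e i)
  | |- context [omap _ (?e i)] => destruct (e i)
  end; cbn [omap obind oapp]; intros;
  try by [];
  try match goal with |- Some _ = Some _ => congr Some end; lia.

Section DegreeLemmas.
Variable k : nat.
Implicit Types (m n p q : mdeg k) (e : edeg k).

Lemma mle_refl m : mle m m. Proof. mdeg_solve. Qed.
Lemma mle0m m : mle 0 m. Proof. mdeg_solve. Qed.
Lemma mle_trans m n p : mle m n -> mle n p -> mle m p.
Proof. by move=> h1 h2; mdeg_solve. Qed.
Lemma mlee_trans m n e : mle m n -> mlee n e -> mlee m e.
Proof. move=> h1 h2; mdeg_solve. Qed.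
Lemma mlee0 e : mlee 0 e. Proof. mdeg_solve. Qed.
Lemma mlee_cap m e : mlee (mcap m e) e. Proof. mdeg_solve. Qed.
Lemma mcap_le m n e : mle m n -> mle (mcap m e) (mcap n e).
Proof. move=> h; mdeg_solve. Qed.
Lemma mcapK m e : mlee m e -> mcap m e = m.
Proof. move=> h; mdeg_solve. Qed.
Lemma msubK m n : mle m n -> m + msub n m = n.
Proof. move=> h; mdeg_solve. Qed.
Lemma maddK m n : msub (m + n) m = n.
Proof. mdeg_solve. Qed.
Lemma mle_addr m n : mle m (m + n). Proof. mdeg_solve. Qed.

End DegreeLemmas.

(* [kpath] is the set of all morphisms and [kvert] the set of objects; [idp]
   identifies the latter with the paths of degree $0$ (see [deg0_id]).
   [kcomp] is only defined on composable pairs.  Countability of the category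
   is the [countType] structure of both types. *)
Record kgraph (k : nat) := KGraph {
  kvert : countType;
  kpath : countType;
  rng : kpath -> kvert;
  src : kpath -> kvert;
  idp : kvert -> kpath;
  kcomp : forall l m : kpath, src l = rng m -> kpath;
  deg : kpath -> mdeg k;
  rng_id : forall v, rng (idp v) = v;
  src_id : forall v, src (idp v) = v;
  rng_comp : forall l m (h : src l = rng m), rng (kcomp h) = rng l;
  src_comp : forall l m (h : src l = rng m), src (kcomp h) = src m;
  comp_idl : forall v l (h : src (idp v) = rng l), kcomp h = l;
  comp_idr : forall v l (h : src l = rng (idp v)), kcomp h = l;
  kcompA : forall l m n (h1 : src l = rng m) (h2 : src m = rng n)
      (h3 : src l = rng (kcomp h2)) (h4 : src (kcomp h1) = rng n),
    kcomp h3 = kcomp h4;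
  deg_id : forall v, deg (idp v) = 0;
  deg_comp : forall l m (h : src l = rng m), deg (kcomp h) = deg l + deg m;
  factorisation : forall l m n, deg l = m + n ->
    exists! ab : kpath * kpath,
      [/\ deg ab.1 = m, deg ab.2 = n
        & exists h : src ab.1 = rng ab.2, kcomp h = l]
}.

Arguments kcomp {k G l m} h : rename.

Section KGraph.
Variables (k : nat) (G : kgraph k).
Implicit Types (v : kvert G) (l a b c : kpath G) (m n p q : mdeg k).

(* $v\Lambda^n$ *)
Definition pathset v n : set (kpath G) := [set l | rng l = v /\ deg l = n].

(* $\Lambda^{\leq n}$ *)
Definition bounded_paths n : set (kpath G) := [set l | mle (deg l) n /\
  forall i, (deg l i < n i)%N -> pathset (src l) (unitm i) = set0].

Definition row_finite : Prop := forall v n, finite_set (pathset v n).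

Definition locally_convex : Prop :=
  forall v (i j : 'I_k) a b, i != j ->
    pathset v (unitm i) a -> pathset v (unitm j) b ->
    pathset (src a) (unitm j) !=set0 /\ pathset (src b) (unitm i) !=set0.

Lemma comp_irr a b a' b' (h : src a = rng b) (h' : src a' = rng b') :
  a = a' -> b = b' -> kcomp h = kcomp h'.
Proof. by move=> ea eb; subst; congr kcomp; exact: eq_irrelevance. Qed.

Lemma deg0_id l : deg l = 0 -> l = idp (rng l).
Proof.
move=> l0; have [ab [_ U]] : exists! ab : kpath G * kpath G,
      [/\ deg ab.1 = 0, deg ab.2 = 0 & exists h : src ab.1 = rng ab.2, kcomp h = l].
  by apply: factorisation; rewrite l0 addr0.
have h1 : src (idp (rng l)) = rng l by rewrite src_id.
have h2 : src l = rng (idp (src l)) by rewrite rng_id.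
have E1 : ab = (idp (rng l), l).
  by apply: U; split; rewrite ?deg_id //; exists h1; rewrite comp_idl.
have E2 : ab = (l, idp (src l)).
  by apply: U; split; rewrite ?deg_id //; exists h2; rewrite comp_idr.
by move: E2; rewrite E1 => -[].
Qed.

Lemma deg0_src l : deg l = 0 -> src l = rng l.
Proof. by move=> /deg0_id ->; rewrite src_id rng_id. Qed.

Lemma comp_inj a b a' b' (h : src a = rng b) (h' : src a' = rng b') :
  deg a = deg a' -> deg b = deg b' -> kcomp h = kcomp h' -> a = a' /\ b = b'.
Proof.
move=> ea eb e; have [ab [_ U]] := factorisation (deg_comp h).
have E1 : ab = (a, b) by apply: U; split=> //; exists h.
have E2 : ab = (a', b') by apply: U; split=> //; exists h'.
by move: E2; rewrite E1 => -[].
Qed.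

Lemma split_subproof l m :
  exists ab : kpath G * kpath G, mle m (deg l) ->
    [/\ deg ab.1 = m, deg ab.2 = msub (deg l) m
      & exists h : src ab.1 = rng ab.2, kcomp h = l].
Proof.
case: (boolP (mle m (deg l))) => [le_m|_]; last by exists (l, l).
have [ab [H _]] := factorisation (esym (msubK le_m)).
by exists ab.
Qed.

(* If $m\leq d(\lambda)$ then $\lambda=$ [kprefix l m] [ksuffix l m], where
   [kprefix l m] has degree $m$. *)
Definition kprefix l m : kpath G := (sval (cid (split_subproof l m))).1.
Definition ksuffix l m : kpath G := (sval (cid (split_subproof l m))).2.

Lemma splitP l m : mle m (deg l) ->
  [/\ deg (kprefix l m) = m, deg (ksuffix l m) = msub (deg l) m
    & exists h : src (kprefix l m) = rng (ksuffix l m), kcomp h = l].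
Proof. exact: svalP (cid (split_subproof l m)). Qed.

Lemma split_comp a b (h : src a = rng b) :
  kprefix (kcomp h) (deg a) = a /\ ksuffix (kcomp h) (deg a) = b.
Proof.
have le_a : mle (deg a) (deg (kcomp h)) by rewrite deg_comp mle_addr.
have [d1 d2 [h' e]] := splitP le_a.
by apply: comp_inj e => //; rewrite d2 deg_comp maddK.
Qed.

Lemma prefix_comp a b (h : src a = rng b) m :
  mle m (deg a) -> kprefix (kcomp h) m = kprefix a m.
Proof.
move=> le_m; have [d1 d2 [h1 e]] := splitP le_m.
set a1 := kprefix a m in d1 h1 e *; set a2 := ksuffix a m in d2 h1 e.
have h2 : src a2 = rng b by rewrite -h -e src_comp.
have h3 : src a1 = rng (kcomp h2) by rewrite rng_comp.
have h4 : src (kcomp h1) = rng b by rewrite src_comp.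
have -> : kcomp h = kcomp h3 by rewrite (kcompA _ h4); apply: comp_irr.
by rewrite -{1}d1 (split_comp h3).1.
Qed.

Lemma rng_prefix l m : mle m (deg l) -> rng (kprefix l m) = rng l.
Proof. by move=> /splitP[_ _ [h e]]; rewrite -[in RHS]e rng_comp. Qed.

Lemma prefix_full l m : deg l = m -> kprefix l m = l.
Proof.
move=> <-; have h : src l = rng (idp (src l)) by rewrite rng_id.
by rewrite -{1}(comp_idr h) (split_comp h).1.
Qed.

Lemma locally_convex_transport l i : locally_convex ->
  deg l i = 0%N -> pathset (rng l) (unitm i) !=set0 ->
  pathset (src l) (unitm i) !=set0.
Proof.
move=> lc; move Ds: (\sum_j deg l j)%N => s.
elim: s l Ds => [|s IHs] l Ds l_i ne.
  rewrite deg0_src //; apply/ffunP=> j; rewrite m0E; apply/eqP.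
  by move/eqP: Ds; rewrite sum_nat_eq0 => /forallP/(_ j).
have [j lj] : exists j, (0 < deg l j)%N.
  apply/existsP; apply: contra_eqT Ds => /existsPn l0.
  by rewrite big1 // => j _; have := l0 j; rewrite lt0n negbK => /eqP.
have ij : i != j by apply: contraTneq lj => <-; rewrite l_i.
have le_j : mle (unitm j) (deg l).
  by apply/mleP=> t; rewrite ffunE; case: eqP => [->|].
have [d1 d2 [h e]] := splitP le_j.
set a := kprefix l _ in d1 h e *; set b := ksuffix l _ in d2 h e *.
have src_b : src b = src l by rewrite -e src_comp.
rewrite -src_b; apply: IHs.
- rewrite d2; apply/eqP; rewrite -eqSS -Ds (bigD1 j) //= [X in _ == X](bigD1 j) //=.
  rewrite !ffunE eqxx; apply/eqP; rewrite -addSn; congr addn; first by lia.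
  by apply: eq_bigr => t tj; rewrite !ffunE (negbTE tj) subn0.
- by rewrite d2 !ffunE l_i sub0n.
- rewrite -h; have [c c_in] := ne.
  have a_in : pathset (rng l) (unitm j) a by split; rewrite // -e rng_comp.
  by have [] := lc _ _ _ _ _ ij c_in a_in.
Qed.

End KGraph.

Arguments pathset {k G}.
Arguments bounded_paths {k G}.
Arguments row_finite {k} G.
Arguments locally_convex {k} G.

Record kfunctor k (G H : kgraph k) := KFunctor {
  kfvert : kvert G -> kvert H;
  kfpath :> kpath G -> kpath H;
  kfrng : forall l, rng (kfpath l) = kfvert (rng l);
  kfsrc : forall l, src (kfpath l) = kfvert (src l);
  kfidp : forall v, kfpath (idp v) = idp (kfvert v);
  kfcomp : forall l m (h : src l = rng m) (h' : src (kfpath l) = rng (kfpath m)),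
    kfpath (kcomp h) = kcomp h';
  kfdeg : forall l, deg (kfpath l) = deg l
}.

Section Omega.
Variables (k : nat) (e : edeg k).

Definition Overt := {p : mdeg k | mlee p e}.
Definition Opath :=
  {pq : mdeg k * mdeg k | mle pq.1 pq.2 && mlee pq.2 e}.
HB.instance Definition _ := Countable.on Overt.
HB.instance Definition _ := Countable.on Opath.

Definition mkOv p (h : mlee p e) : Overt := exist _ p h.
Definition mkOp p q (h : mle p q && mlee q e) : Opath := exist _ (p, q) h.

Definition Orng (f : Opath) : Overt :=
  mkOv (mlee_trans (andP (valP f)).1 (andP (valP f)).2).
Definition Osrc (f : Opath) : Overt := mkOv (andP (valP f)).2.

Fact Oidp_subproof (v : Overt) : mle (val v) (val v) && mlee (val v) e.
Proof. by rewrite mle_refl (valP v). Qed.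
Definition Oidp (v : Overt) : Opath := mkOp (Oidp_subproof v).

Fact Ocomp_subproof (f g : Opath) : Osrc f = Orng g ->
  mle (val f).1 (val g).2 && mlee (val g).2 e.
Proof.
move=> /(congr1 val) /= h.
have /andP[hf _] := valP f; have /andP[hg ->] := valP g; rewrite andbT.
by apply: mle_trans hf _; rewrite h.
Qed.
Definition Ocomp (f g : Opath) (h : Osrc f = Orng g) : Opath :=
  mkOp (Ocomp_subproof h).

Definition Odeg (f : Opath) : mdeg k := msub (val f).2 (val f).1.

Lemma Opath_eq (f g : Opath) : (val f).1 = (val g).1 -> (val f).2 = (val g).2 -> f = g.
Proof.
move=> e1 e2; apply: val_inj; move: e1 e2.
by case: (val f) (val g) => [? ?] [? ?] /= -> ->.
Qed.

Fact Ofactorisation (f : Opath) m n : Odeg f = m + n ->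
  exists! ab : Opath * Opath,
    [/\ Odeg ab.1 = m, Odeg ab.2 = n
      & exists h : Osrc ab.1 = Orng ab.2, Ocomp h = f].
Proof.
case: f => -[p q] /= pqe; rewrite /Odeg /= => dmn.
have /andP[pq qe] := pqe.
have h1 : mle p (p + m) && mlee (p + m) e by mdeg_solve.
have h2 : mle (p + m) q && mlee q e by mdeg_solve.
exists (mkOp h1, mkOp h2); split.
  split=> /=; [by rewrite maddK| by mdeg_solve|].
  have h : Osrc (mkOp h1) = Orng (mkOp h2) by apply: val_inj.
  by exists h; apply: Opath_eq.
move=> [[[p1 q1] /= f1] [[p2 q2] /= f2]] /= [d1 d2 [h E]].
have /= E1 := congr1 (fun f : Opath => (val f).1) E.
have /= E2 := congr1 (fun f : Opath => (val f).2) E.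
have /= E3 := congr1 val h.
subst p1 q2 q1; congr pair; apply: Opath_eq => //=; clear -d1 d2 f1 f2; mdeg_solve.
Qed.

Definition Omega : kgraph k.
Proof.
refine (@KGraph k Overt Opath Orng Osrc Oidp Ocomp Odeg
  _ _ _ _ _ _ _ _ _ Ofactorisation).
- by move=> v; apply: val_inj.
- by move=> v; apply: val_inj.
- by move=> l m h; apply: val_inj.
- by move=> l m h; apply: val_inj.
- by move=> v l h; apply: Opath_eq => //=; have /= -> := congr1 val h.
- by move=> v l h; apply: Opath_eq => //=; have /= := congr1 val h.
- by move=> *; apply: Opath_eq.
- by move=> v; rewrite /Odeg; mdeg_solve.
- move=> [[p q] /= f] [[p' q'] /= g] h; rewrite /Odeg /=.
  have /= E := congr1 val h; subst p'; clear h; mdeg_solve.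
Defined.

End Omega.

Record bpath k (G : kgraph k) := BPath {
  bdeg : edeg k;
  bfun :> kfunctor (Omega bdeg) G;
  bbound : forall (p : kvert (Omega bdeg)) i, bdeg i = Some (val p i) ->
    pathset (kfvert bfun p) (unitm i) = set0
}.

Section Finiteness.
Variables (k : nat) (G : kgraph k).

Lemma finite_mle (n : mdeg k) : finite_set [set m | mle m n].
Proof.
pose N := (\max_i n i).+1.
pose f (g : {ffun 'I_k -> 'I_N}) : mdeg k := [ffun i => nat_of_ord (g i)].
apply: (@sub_finite_set _ _ (f @` setT)); last exact/finite_image/finite_finset.
move=> m /= /mleP le_m; exists [ffun i => inord (m i)] => //.
apply/ffunP=> i; rewrite !ffunE inordK // ltnS.
exact: leq_trans (le_m i) (leq_bigmax i).
Qed.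

Lemma finite_mle_paths (v : kvert G) (n : mdeg k) : row_finite G ->
  finite_set [set l | rng l = v /\ mle (deg l) n].
Proof.
move=> rf; apply: (@sub_finite_set _ _ (\bigcup_(m in [set m | mle m n]) pathset v m)).
  by move=> l [lv ln]; exists (deg l).
by apply: bigcup_finite => [|m _]; [exact: finite_mle|exact: rf].
Qed.

Lemma finite_bounded_paths (v : kvert G) (n : mdeg k) : row_finite G ->
  finite_set [set l | rng l = v /\ bounded_paths n l].
Proof.
move=> rf; apply: sub_finite_set (finite_mle_paths v n rf).
by move=> l [? []].
Qed.

End Finiteness.

Section BoundaryPaths.
Variables (k : nat) (G : kgraph k).
Implicit Types (x y z : bpath G) (m n p q : mdeg k) (l : kpath G).

(* $x(m\wedge d(x))$ *)
Definition bvtx x m : kvert G := kfvert x (mkOv (mlee_cap m (bdeg x))).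

Fact bseg_subproof x m n : mle m n ->
  mle (mcap m (bdeg x)) (mcap n (bdeg x)) && mlee (mcap n (bdeg x)) (bdeg x).
Proof. by move=> mn; rewrite mcap_le ?mlee_cap. Qed.

(* $x(m\wedge d(x),n\wedge d(x))$ *)
Definition bseg x m n (mn : mle m n) : kpath G := x (mkOp (bseg_subproof x mn)).

Definition brng x : kvert G := kfvert x (mkOv (mlee0 (bdeg x))).

Lemma bvtx_eq x m n :
  mcap m (bdeg x) = mcap n (bdeg x) -> bvtx x m = bvtx x n.
Proof. by move=> e; congr kfvert; apply: val_inj. Qed.

Lemma bvtx0 x : bvtx x 0 = brng x.
Proof. by congr kfvert; apply: val_inj => /=; mdeg_solve. Qed.

Lemma bseg_eq x m n m' n' (h : mle m n) (h' : mle m' n') :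
  mcap m (bdeg x) = mcap m' (bdeg x) -> mcap n (bdeg x) = mcap n' (bdeg x) ->
  bseg x h = bseg x h'.
Proof. by move=> e1 e2; congr kfpath; apply: Opath_eq. Qed.

Lemma rng_bseg x m n (h : mle m n) : rng (bseg x h) = bvtx x m.
Proof. by rewrite kfrng; congr kfvert; apply: val_inj. Qed.

Lemma src_bseg x m n (h : mle m n) : src (bseg x h) = bvtx x n.
Proof. by rewrite kfsrc; congr kfvert; apply: val_inj. Qed.

Lemma deg_bseg x m n (h : mle m n) :
  deg (bseg x h) = msub (mcap n (bdeg x)) (mcap m (bdeg x)).
Proof. by rewrite kfdeg. Qed.

Lemma comp_bseg x m n p (h1 : mle m n) (h2 : mle n p) (h3 : mle m p)
  (h : src (bseg x h1) = rng (bseg x h2)) : kcomp h = bseg x h3.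
Proof.
have h' : Osrc (mkOp (bseg_subproof x h1)) = Orng (mkOp (bseg_subproof x h2)).
  exact: val_inj.
rewrite -(@kfcomp _ _ _ x _ _ h' h); congr kfpath; exact: Opath_eq.
Qed.

Lemma bseg_id x m (h : mle m m) : bseg x h = idp (bvtx x m).
Proof. by rewrite -(@kfidp _ _ _ x); congr kfpath; apply: Opath_eq. Qed.

Lemma bvtx_bound x m i : bdeg x i = Some (mcap m (bdeg x) i) ->
  pathset (bvtx x m) (unitm i) = set0.
Proof. exact: (@bbound _ _ x (mkOv (mlee_cap m (bdeg x)))). Qed.

Section Shift.
Variables (x : bpath G) (n : mdeg k) (n_le : mlee n (bdeg x)).

Fact shift_vert_subproof (p : kvert (Omega (esub (bdeg x) n))) :
  mlee (n + val p) (bdeg x).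
Proof. by case: p => p /= h; have hn := n_le; mdeg_solve. Qed.

Fact shift_path_subproof (f : kpath (Omega (esub (bdeg x) n))) :
  mle (n + (val f).1) (n + (val f).2) && mlee (n + (val f).2) (bdeg x).
Proof. by case: f => -[p q] /= h; mdeg_solve. Qed.

Definition shift_functor : kfunctor (Omega (esub (bdeg x) n)) G.
Proof.
refine (@KFunctor k (Omega (esub (bdeg x) n)) G
  (fun v => kfvert x (mkOv (shift_vert_subproof v)))
  (fun f => x (mkOp (shift_path_subproof f))) _ _ _ _ _).
- by move=> f; rewrite kfrng; congr kfvert; apply: val_inj.
- by move=> f; rewrite kfsrc; congr kfvert; apply: val_inj.
- by move=> v; rewrite -(@kfidp _ _ _ x); congr kfpath; apply: Opath_eq.
- move=> f g h h'.
  have h1 : Osrc (mkOp (shift_path_subproof f)) = Orng (mkOp (shift_path_subproof g)).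
    by apply: val_inj => /=; have /= -> := congr1 val h.
  by rewrite -(@kfcomp _ _ _ x _ _ h1 h'); congr kfpath; apply: Opath_eq.
- by case=> -[p q] /= h; rewrite kfdeg /= /Odeg /=; clear h; mdeg_solve.
Defined.

Fact shift_bound (p : kvert (Omega (esub (bdeg x) n))) i :
  esub (bdeg x) n i = Some (val p i) ->
  pathset (kfvert shift_functor p) (unitm i) = set0.
Proof.
move=> e; apply: (@bbound _ _ x (mkOv (shift_vert_subproof p))); rewrite /= maddE; move: e; rewrite ffunE.
move/mleeP/(_ i): n_le; case: (bdeg x i) => //= a n_a [<-].
by rewrite subnKC.
Qed.

(* $\sigma^n(x)$ *)
Definition bshift : bpath G := BPath shift_bound.

Lemma bvtx_shift m : bvtx bshift m = bvtx x (n + m).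
Proof.
rewrite /bvtx /=; congr kfvert; apply: val_inj => /=.
by move: n_le => h; mdeg_solve.
Qed.

Lemma bseg_shift m p (h : mle m p) (h' : mle (n + m) (n + p)) :
  bseg bshift h = bseg x h'.
Proof.
rewrite /bseg /=; congr kfpath; apply: Opath_eq => /=;
by move: n_le => hn; clear h h'; mdeg_solve.
Qed.

End Shift.

(* A functor on $\Omega_{k,e}$ is determined by the paths $W_q=x(0,q)$. *)
Section FunctorOfInitialSegments.
Variables (e : edeg k) (W : mdeg k -> kpath G).
Hypothesis degW : forall q, mlee q e -> deg (W q) = q.
Hypothesis prefixW : forall p q, mle p q -> mlee q e -> kprefix (W q) p = W p.

Fact splitW p q : mle p q -> mlee q e ->
  deg (ksuffix (W q) p) = msub q p /\
  exists h : src (W p) = rng (ksuffix (W q) p), kcomp h = W q.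
Proof.
move=> pq qe; have pW : mle p (deg (W q)) by rewrite degW.
by have [_ d2 H] := splitP pW; rewrite prefixW in H => //; rewrite d2 degW.
Qed.

Definition functor_of_segs : kfunctor (Omega e) G.
Proof.
refine (@KFunctor k (Omega e) G
  (fun v => src (W (val v))) (fun f => ksuffix (W (val f).2) (val f).1) _ _ _ _ _).
- by case=> -[p q] /= /andP[pq qe]; have [_ [h _]] := splitW pq qe.
- by case=> -[p q] /= /andP[pq qe]; have [_ [h E]] := splitW pq qe; rewrite -[in RHS]E src_comp.
- case=> p /= pe; have [d [h E]] := splitW (mle_refl p) pe.
  by rewrite h; apply: deg0_id; rewrite d; mdeg_solve.
- move=> [[p q] /= f] [[q' t] /= g] h h'; have /= E := congr1 val h; subst q'.
  have [/andP[pq qe] /andP[qt te]] := (f, g).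
  have [d1 [h1 E1]] := splitW pq qe; have [d2 [h2 E2]] := splitW qt te.
  have [d3 [h3 E3]] := splitW (mle_trans pq qt) te.
  have h4 : src (W p) = rng (kcomp h') by rewrite rng_comp.
  have h5 : src (kcomp h1) = rng (ksuffix (W t) q) by rewrite E1.
  have E4 : kcomp h4 = kcomp h3.
    by rewrite (kcompA h4 h5) E3; apply: etrans E2; apply: comp_irr.
  have [] // := comp_inj _ _ E4.
  by rewrite deg_comp d1 d2 d3; clear -pq qt; mdeg_solve.
- by case=> -[p q] /= f; have /andP[pq qe] := f; have [] := splitW pq qe.
Defined.

End FunctorOfInitialSegments.

Section Concatenation.
Hypothesis lc : locally_convex G.
Variables (l : kpath G) (x : bpath G) (lx : src l = brng x).

Fact concat_subproof q : src l = rng (bseg x (mle0m q)).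
Proof. by rewrite rng_bseg bvtx0. Qed.

(* $\lambda x(0,q)$, with $q$ truncated to $d(x)$ *)
Definition concat_long q : kpath G := kcomp (concat_subproof q).

(* $(\lambda x)(0,q)$ *)
Definition concat_seg q : kpath G := kprefix (concat_long (msub q (deg l))) q.

Fact deg_concat_long q : deg (concat_long q) = deg l + mcap q (bdeg x).
Proof. by rewrite deg_comp deg_bseg; congr (_ + _); mdeg_solve. Qed.

Fact concat_le q : mlee q (eadd (deg l) (bdeg x)) ->
  mle q (deg (concat_long (msub q (deg l)))).
Proof. by move=> h; rewrite deg_concat_long; mdeg_solve. Qed.

Fact deg_concat_seg q : mlee q (eadd (deg l) (bdeg x)) -> deg (concat_seg q) = q.
Proof. by move=> /concat_le/splitP[]. Qed.

Fact concat_longD p q (pq : mle p q) :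
  exists h : src (concat_long p) = rng (bseg x pq), kcomp h = concat_long q.
Proof.
have h : src (concat_long p) = rng (bseg x pq) by rewrite src_comp src_bseg rng_bseg.
exists h; have h1 : src (bseg x (mle0m p)) = rng (bseg x pq).
  by rewrite src_bseg rng_bseg.
have h2 : src l = rng (kcomp h1) by rewrite rng_comp (concat_subproof p).
by rewrite -(kcompA h2 h); apply: comp_irr => //; apply: comp_bseg.
Qed.

Fact prefix_prefix (a : kpath G) p q : mle p q -> mle q (deg a) ->
  kprefix (kprefix a q) p = kprefix a p.
Proof.
move=> pq /splitP[d1 _ [h E]].
by rewrite -[in RHS]E prefix_comp // d1.
Qed.

Fact prefix_concat_seg p q : mle p q -> mlee q (eadd (deg l) (bdeg x)) ->
  kprefix (concat_seg q) p = concat_seg p.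
Proof.
move=> pq qe; rewrite prefix_prefix ?concat_le //.
have pq' : mle (msub p (deg l)) (msub q (deg l)) by mdeg_solve.
have [h <-] := concat_longD pq'.
by rewrite prefix_comp // concat_le // (mlee_trans pq).
Qed.

Definition concat_functor : kfunctor (Omega (eadd (deg l) (bdeg x))) G :=
  functor_of_segs deg_concat_seg prefix_concat_seg.

Fact concat_bound (p : kvert (Omega (eadd (deg l) (bdeg x)))) i :
  eadd (deg l) (bdeg x) i = Some (val p i) ->
  pathset (kfvert concat_functor p) (unitm i) = set0.
Proof.
case: p => p /= pe pi.
pose q := deg l + msub p (deg l).
have pq : mle p q by rewrite /q; mdeg_solve.
have qe : mlee q (eadd (deg l) (bdeg x)) by rewrite /q; mdeg_solve.
have [d [h E]] := splitW deg_concat_seg prefix_concat_seg pq qe.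
have qE : msub q (deg l) = msub p (deg l) by rewrite /q maddK.
have srcq : src (concat_seg q) = bvtx x (msub p (deg l)).
  rewrite /concat_seg prefix_full; first by rewrite src_comp src_bseg qE.
  by rewrite deg_concat_long qE mcapK // /q; clear -pe; mdeg_solve.
apply: contrapT => /eqP/set0P ne.
have : pathset (bvtx x (msub p (deg l))) (unitm i) !=set0.
  rewrite -srcq -E src_comp; apply: locally_convex_transport => //.
    rewrite d /q !ffunE; move: pi; rewrite ffunE.
    by case: (bdeg x i) => //= a [<-]; lia.
  by rewrite -h.
move/set0P/eqP; apply; apply: bvtx_bound.
rewrite mcapK; last by clear -pe; mdeg_solve.
move: pi; rewrite !ffunE; case: (bdeg x i) => //= a [<-].
by rewrite addnC addnK.
Qed.

(* $\lambda x$ *)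
Definition bconcat : bpath G := BPath concat_bound.

Lemma bseg_concat_initial (h : mle 0 (deg l)) : bseg bconcat h = l.
Proof.
rewrite /bseg /=.
have -> : mcap (deg l) (eadd (deg l) (bdeg x)) = deg l by mdeg_solve.
have -> : mcap 0 (eadd (deg l) (bdeg x)) = 0 by mdeg_solve.
have le0 : mlee (deg l) (eadd (deg l) (bdeg x)) by mdeg_solve.
have e0 : mlee 0 (eadd (deg l) (bdeg x)) by mdeg_solve.
have [d [h1 E]] := splitW deg_concat_seg prefix_concat_seg (mle0m (deg l)) le0.
have W0 : concat_seg 0 = idp (rng (ksuffix (concat_seg (deg l)) 0)).
  by rewrite -h1 deg0_src ?deg_concat_seg //; apply: deg0_id; rewrite deg_concat_seg.
have h2 : src (idp (rng (ksuffix (concat_seg (deg l)) 0)))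
  = rng (ksuffix (concat_seg (deg l)) 0) by rewrite src_id.
rewrite -[LHS](comp_idl h2) -(comp_irr h1 h2 W0 erefl) E.
by rewrite /concat_seg (split_comp _).1.
Qed.

Lemma bvtx_concat m : bvtx bconcat (deg l + m) = bvtx x m.
Proof.
have -> : bvtx x m = src (concat_long m) by rewrite src_comp src_bseg.
rewrite /bvtx /=.
have -> : mcap (deg l + m) (eadd (deg l) (bdeg x)) = deg l + mcap m (bdeg x).
  by mdeg_solve.
rewrite /concat_seg maddK prefix_full.
  by rewrite !src_comp !src_bseg; apply: bvtx_eq; mdeg_solve.
by rewrite deg_concat_long; congr (_ + _); mdeg_solve.
Qed.

Lemma bseg_concat m n (h : mle m n) (h' : mle (deg l + m) (deg l + n)) :
  bseg bconcat h' = bseg x h.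
Proof.
have W q : concat_seg (deg l + mcap q (bdeg x)) = concat_long q.
  rewrite /concat_seg maddK prefix_full.
    by apply: comp_irr => //; apply: bseg_eq => //; mdeg_solve.
  by rewrite deg_concat_long; congr (_ + _); mdeg_solve.
rewrite /bseg /=.
have E q : mcap (deg l + q) (eadd (deg l) (bdeg x)) = deg l + mcap q (bdeg x).
  by mdeg_solve.
rewrite !E W; have [h1 <-] := concat_longD h.
by rewrite -deg_concat_long (split_comp _).2.
Qed.

End Concatenation.

End BoundaryPaths.

Section Desourcification.
Variables (k : nat) (G : kgraph k).
Implicit Types (x y z : bpath G) (m n p q : mdeg k).

(* $m-m\wedge d(x)$ *)
Definition overhang x m : mdeg k := msub m (mcap m (bdeg x)).

Record pre_path := PrePath {
  pp_path : bpath G;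
  pp_lo : mdeg k;
  pp_hi : mdeg k;
  pp_le : mle pp_lo pp_hi
}.

(* The relation $\approx$ *)
Definition dvert_rel : rel {classic bpath G * mdeg k} := fun a b =>
  (bvtx a.1 a.2 == bvtx b.1 b.2) && (overhang a.1 a.2 == overhang b.1 b.2).

(* The relation $\sim$ *)
Definition dpath_rel : rel {classic pre_path} := fun a b =>
  [&& bseg (pp_path a) (pp_le a) == bseg (pp_path b) (pp_le b),
      overhang (pp_path a) (pp_lo a) == overhang (pp_path b) (pp_lo b)
    & msub (pp_hi a) (pp_lo a) == msub (pp_hi b) (pp_lo b)].

Fact dvert_refl : reflexive dvert_rel.
Proof. by move=> a; rewrite /dvert_rel !eqxx. Qed.
Fact dvert_sym : symmetric dvert_rel.
Proof. by move=> a b; rewrite /dvert_rel !(eq_sym (_ a.1 _)). Qed.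
Fact dvert_trans : transitive dvert_rel.
Proof. by move=> b a c /andP[/eqP h1 /eqP h2]; rewrite /dvert_rel h1 h2. Qed.
Canonical dvert_equiv := EquivRel dvert_rel dvert_refl dvert_sym dvert_trans.

Fact dpath_refl : reflexive dpath_rel.
Proof. by move=> a; rewrite /dpath_rel !eqxx. Qed.
Fact dpath_sym : symmetric dpath_rel.
Proof.
move=> a b; rewrite /dpath_rel (eq_sym (bseg _ _)) (eq_sym (overhang _ _)).
by rewrite (eq_sym (msub _ _)).
Qed.
Fact dpath_trans : transitive dpath_rel.
Proof. by move=> b a c /and3P[/eqP h1 /eqP h2 /eqP h3]; rewrite /dpath_rel h1 h2 h3. Qed.
Canonical dpath_equiv := EquivRel dpath_rel dpath_refl dpath_sym dpath_trans.

Definition dvert := {eq_quot dvert_equiv}.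
Definition dpath := {eq_quot dpath_equiv}.
HB.instance Definition _ := Choice.on dvert.
HB.instance Definition _ := Quotient.on dvert.
HB.instance Definition _ := Choice.on dpath.
HB.instance Definition _ := Quotient.on dpath.

(* $[x;m]$ *)
Definition vclass x m : dvert := \pi_dvert ((x, m) : {classic bpath G * mdeg k}).
(* $[x;(m,n)]$ *)
Definition pclass x m n (mn : mle m n) : dpath :=
  \pi_dpath (PrePath x mn : {classic pre_path}).

Lemma vclassP x y m p :
  vclass x m = vclass y p <->
  bvtx x m = bvtx y p /\ overhang x m = overhang y p.
Proof.
split=> [/eqmodP/andP[/eqP ? /eqP ?] //|[h1 h2]].
by apply/eqmodP; rewrite /= /dvert_rel /= h1 h2 !eqxx.
Qed.

Lemma pclassP x y m n p q (mn : mle m n) (pq : mle p q) :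
  pclass x mn = pclass y pq <->
  [/\ bseg x mn = bseg y pq, overhang x m = overhang y p & msub n m = msub q p].
Proof.
split=> [/eqmodP/and3P[/eqP ? /eqP ? /eqP ?] //|[h1 h2 h3]].
by apply/eqmodP; rewrite /= /dpath_rel /= h1 h2 h3 !eqxx.
Qed.

Definition vrep_path (v : dvert) : bpath G := (repr v : bpath G * mdeg k).1.
Definition vrep_deg (v : dvert) : mdeg k := (repr v : bpath G * mdeg k).2.
Definition prep (l : dpath) : pre_path := repr l.

Lemma vclassK v : vclass (vrep_path v) (vrep_deg v) = v.
Proof.
rewrite /vclass -[RHS]reprK /vrep_path /vrep_deg.
by case: (repr v).
Qed.

Lemma pclassK l : pclass (pp_path (prep l)) (pp_le (prep l)) = l.
Proof.
rewrite /pclass -[RHS]reprK /prep.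
by case: (repr l).
Qed.

(* Countability: a class is determined by the data that occur in the relation. *)
Definition vinv (v : dvert) : kvert G * mdeg k :=
  (bvtx (vrep_path v) (vrep_deg v), overhang (vrep_path v) (vrep_deg v)).
Definition pinv (l : dpath) : kpath G * mdeg k * mdeg k :=
  let a := prep l in
  (bseg (pp_path a) (pp_le a), overhang (pp_path a) (pp_lo a),
   msub (pp_hi a) (pp_lo a)).

Lemma vinv_inj : injective vinv.
Proof.
by move=> u v [h1 h2]; rewrite -(vclassK u) -(vclassK v); apply/vclassP.
Qed.

Lemma pinv_inj : injective pinv.
Proof.
by move=> a b [h1 h2 h3]; rewrite -(pclassK a) -(pclassK b); apply/pclassP.
Qed.

Lemma vinvE x m : vinv (vclass x m) = (bvtx x m, overhang x m).
Proof.
by have /vclassP[h1 h2] := vclassK (vclass x m); rewrite /vinv h1 h2.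
Qed.

Lemma pinvE x m n (mn : mle m n) :
  pinv (pclass x mn) = (bseg x mn, overhang x m, msub n m).
Proof.
by have /pclassP[h1 h2 h3] := pclassK (pclass x mn); rewrite /pinv h1 h2 h3.
Qed.

Lemma unpickle_subproof (T : choiceType) (C : countType) (f : T -> C) :
  injective f -> {g : nat -> option T | pcancel (pickle \o f) g}.
Proof.
move=> f_inj; exists (fun i => match pselect (exists t, pickle (f t) = i) with
  | left e => Some (sval (cid e)) | right _ => None end).
move=> t /=; case: pselect => [e|]; last by case; exists t.
by congr Some; apply: f_inj; apply: (pcan_inj pickleK); case: cid.
Qed.

HB.instance Definition _ :=
  isCountable.Build dvert (svalP (unpickle_subproof vinv_inj)).
HB.instance Definition _ :=
  isCountable.Build dpath (svalP (unpickle_subproof pinv_inj)).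

Definition drng (l : dpath) : dvert := vclass (pp_path (prep l)) (pp_lo (prep l)).
Definition dsrc (l : dpath) : dvert := vclass (pp_path (prep l)) (pp_hi (prep l)).
Definition didp (v : dvert) : dpath :=
  pclass (vrep_path v) (mle_refl (vrep_deg v)).
Definition ddeg (l : dpath) : mdeg k := msub (pp_hi (prep l)) (pp_lo (prep l)).

Lemma pclass_ends x y m n p q (mn : mle m n) (pq : mle p q) :
  pclass x mn = pclass y pq -> vclass x m = vclass y p /\ vclass x n = vclass y q.
Proof.
move=> /pclassP[h1 h2 h3]; split; apply/vclassP; split=> //.
- by rewrite -(rng_bseg x mn) h1 rng_bseg.
- by rewrite -(src_bseg x mn) h1 src_bseg.
have := congr1 (@deg _ G) h1; rewrite !deg_bseg; move: h2; rewrite /overhang => h2 h4.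
apply/ffunP => i; move/ffunP/(_ i): h2; move/ffunP/(_ i): h3; move/ffunP/(_ i): h4.
have /mleP/(_ i) := mn; have /mleP/(_ i) := pq; rewrite !ffunE.
by case: (bdeg x i) => [a|]; case: (bdeg y i) => [b|]; lia.
Qed.

Lemma drngE x m n (mn : mle m n) : drng (pclass x mn) = vclass x m.
Proof. by have [] := pclass_ends (pclassK (pclass x mn)). Qed.
Lemma dsrcE x m n (mn : mle m n) : dsrc (pclass x mn) = vclass x n.
Proof. by have [] := pclass_ends (pclassK (pclass x mn)). Qed.
Lemma ddegE x m n (mn : mle m n) : ddeg (pclass x mn) = msub n m.
Proof. by have /pclassP[] := pclassK (pclass x mn). Qed.

Lemma didpE x m (h : mle m m) : didp (vclass x m) = pclass x h.
Proof.
have /vclassP[h1 h2] := vclassK (vclass x m).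
apply/pclassP; split=> //; first by rewrite !bseg_id h1.
by mdeg_solve.
Qed.

Section Composition.
Hypothesis lc : locally_convex G.

Fact dcomp_src_subproof x y n p : vclass x n = vclass y p ->
  src (bseg x (mle0m n)) = brng (bshift (mlee_cap p (bdeg y))).
Proof.
move=> /vclassP[h _]; rewrite src_bseg h -bvtx0 bvtx_shift.
by apply: bvtx_eq; mdeg_solve.
Qed.

Fact dcomp_le_subproof m n p q : mle m n -> mle p q -> mle m (msub (n + q) p).
Proof. by move=> h1 h2; mdeg_solve. Qed.

(* $x(0,n\wedge d(x))\,\sigma^{p\wedge d(y)}(y)$ *)
Definition dglue x y n p (h : vclass x n = vclass y p) : bpath G :=
  bconcat lc (dcomp_src_subproof h).

Definition dcomp (a b : dpath) (h : dsrc a = drng b) : dpath :=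
  pclass (dglue h) (dcomp_le_subproof (pp_le (prep a)) (pp_le (prep b))).

Lemma pinv_glue x y m n p q (mn : mle m n) (pq : mle p q)
    (h : vclass x n = vclass y p) (h' : src (bseg x mn) = rng (bseg y pq)) :
  pinv (pclass (dglue h) (dcomp_le_subproof mn pq)) =
  (kcomp h', overhang x m, msub n m + msub q p).
Proof.
have /vclassP[_ hov] := h.
rewrite pinvE; set z := dglue h.
pose l := bseg x (mle0m n).
have dl : deg l = mcap n (bdeg x) by rewrite deg_bseg; mdeg_solve.
have dz : bdeg z = eadd (mcap n (bdeg x)) (esub (bdeg y) (mcap p (bdeg y))).
  by rewrite /z /dglue /= dl.
have dzm : mcap m (bdeg z) = mcap m (bdeg x).
  rewrite dz; apply/ffunP=> i; move/ffunP/(_ i): hov; rewrite !ffunE.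
  have /mleP/(_ i) := mn.
  by case: (bdeg x i) => [a|]; case: (bdeg y i) => [b|] /=; lia.
congr (_, _, _); last by have [mn' pq'] := (mn, pq); mdeg_solve.
  have ml : mle (mcap m (bdeg x)) (deg l).
    by rewrite dl mcap_le.
  have hs : src (bseg z ml) = rng (bseg z (mle_addr (deg l) (msub (mcap q (bdeg y)) (mcap p (bdeg y))))).
    by rewrite src_bseg rng_bseg.
  have e1 : bseg z ml = bseg x mn.
    have zl : bseg z (mle0m (deg l)) = l by exact: bseg_concat_initial.
    have g1 : src (bseg z (mle0m (mcap m (bdeg x)))) = rng (bseg z ml).
      by rewrite src_bseg rng_bseg.
    have g2 : src (bseg x (mle0m m)) = rng (bseg x mn).
      by rewrite src_bseg rng_bseg.
    have := comp_bseg (mle0m (deg l)) g1; rewrite zl => E.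
    have E2 := comp_bseg (mle0m n) g2.
    have [] // := comp_inj _ _ (etrans E (esym E2)).
      by rewrite !deg_bseg -dzm; mdeg_solve.
    rewrite (deg_bseg z) (deg_bseg x mn) dl; have -> : mcap (mcap m (bdeg x)) (bdeg z) = mcap m (bdeg x).
      by rewrite -dzm; mdeg_solve.
    by congr msub; rewrite dz; mdeg_solve.
  have e2 : bseg z (mle_addr (deg l) (msub (mcap q (bdeg y)) (mcap p (bdeg y)))) = bseg y pq.
    have l0 : mle (deg l + 0) (deg l + msub (mcap q (bdeg y)) (mcap p (bdeg y))).
      by mdeg_solve.
    rewrite -(@bseg_eq _ _ z _ _ _ _ l0) ?addr0 // /z /dglue.
    rewrite (bseg_concat _ _ (mle0m _)).
    have pp : mle (mcap p (bdeg y) + 0) (mcap p (bdeg y) + msub (mcap q (bdeg y)) (mcap p (bdeg y))).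
      by mdeg_solve.
    by rewrite (bseg_shift _ _ pp); have pq' := pq; apply: bseg_eq; mdeg_solve.
  rewrite -(comp_irr hs h' e1 e2).
  have mq : mle (mcap m (bdeg x)) (deg l + msub (mcap q (bdeg y)) (mcap p (bdeg y))).
    by apply: mle_trans ml (mle_addr _ _).
  rewrite (comp_bseg mq); apply: bseg_eq.
    by rewrite -dzm; mdeg_solve.
  rewrite dz dl; apply/ffunP=> i; move/ffunP/(_ i): hov; rewrite !ffunE.
  have /mleP/(_ i) := mn; have /mleP/(_ i) := pq.
  by case: (bdeg x i) => [a|]; case: (bdeg y i) => [b|] /=; lia.
by rewrite /overhang dzm.
Qed.

Let plam (l : dpath) : kpath G := (pinv l).1.1.

Fact dcomp_composable (a b : dpath) : dsrc a = drng b -> src (plam a) = rng (plam b).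
Proof. by move=> /vclassP[h _]; rewrite /plam /pinv /= src_bseg rng_bseg. Qed.

Lemma pinv_dcomp (a b : dpath) (h : dsrc a = drng b)
    (h' : src (plam a) = rng (plam b)) :
  pinv (dcomp h) = (kcomp h', (pinv a).1.2, (pinv a).2 + (pinv b).2).
Proof. exact: pinv_glue. Qed.

(* [dcomp] does not depend on the choice of representatives. *)
Lemma dcompE x y m n p q (mn : mle m n) (pq : mle p q)
    (h : dsrc (pclass x mn) = drng (pclass y pq)) (h0 : vclass x n = vclass y p) :
  dcomp h = pclass (dglue h0) (dcomp_le_subproof mn pq).
Proof.
apply: pinv_inj; have h1 := dcomp_composable h.
have h2 : src (bseg x mn) = rng (bseg y pq) by move: (h1); rewrite /plam !pinvE.
rewrite (pinv_dcomp h h1) (pinv_glue _ h2); congr (_, _, _).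
- by apply: comp_irr; rewrite /plam pinvE.
- by rewrite pinvE.
- by rewrite !pinvE.
Qed.

Lemma vinv_drng l : vinv (drng l) = (rng (plam l), (pinv l).1.2).
Proof. by rewrite vinvE /plam /pinv /= rng_bseg. Qed.

Lemma plam_le l : mle (deg (plam l)) (pinv l).2.
Proof.
rewrite /plam /pinv /= deg_bseg; have := pp_le (prep l).
by move: (pp_lo _) (pp_hi _) => m n mn; mdeg_solve.
Qed.

Lemma vinv_dsrc l :
  vinv (dsrc l) = (src (plam l), msub ((pinv l).1.2 + (pinv l).2) (deg (plam l))).
Proof.
rewrite vinvE /plam /pinv /= src_bseg deg_bseg /overhang; congr pair.
by have := pp_le (prep l); move: (pp_lo _) (pp_hi _) => m n mn; mdeg_solve.
Qed.

Lemma plam_min (a b : dpath) i : dsrc a = drng b ->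
  deg (plam a) i = minn ((pinv a).2 i) ((deg (plam a) + deg (plam b))%R i).
Proof.
move=> /vclassP[_]; rewrite /plam /pinv /overhang /= !deg_bseg => /ffunP/(_ i).
have /mleP/(_ i) := pp_le (prep a); have /mleP/(_ i) := pp_le (prep b).
rewrite maddE !ffunE; case: (bdeg (pp_path (prep a)) i) => [?|];
  case: (bdeg (pp_path (prep b)) i) => [?|]; lia.
Qed.

Lemma didp_inv v : pinv (didp v) = (idp (vinv v).1, (vinv v).2, 0).
Proof. by rewrite pinvE bseg_id; congr (_, _, _); mdeg_solve. Qed.

Lemma drng_id v : drng (didp v) = v. Proof. by rewrite drngE vclassK. Qed.
Lemma dsrc_id v : dsrc (didp v) = v. Proof. by rewrite dsrcE vclassK. Qed.

Lemma drng_comp a b (h : dsrc a = drng b) : drng (dcomp h) = drng a.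
Proof.
apply: vinv_inj; have h' := dcomp_composable h.
by rewrite !vinv_drng /plam (pinv_dcomp h h') /= rng_comp.
Qed.

Lemma dsrc_comp a b (h : dsrc a = drng b) : dsrc (dcomp h) = dsrc b.
Proof.
apply: vinv_inj; have h' := dcomp_composable h.
rewrite !vinv_dsrc {1 2}/plam (pinv_dcomp h h') /= src_comp deg_comp.
congr pair; have := congr1 (fun v => (vinv v).2) h.
rewrite vinv_dsrc vinv_drng /= => <-.
have := plam_le a; have := plam_le b.
rewrite /= -/(plam a) -/(plam b).
move: (deg (plam a)) (deg (plam b)) (overhang _ _)
  (msub (pp_hi (prep a)) _) (msub (pp_hi (prep b)) _).
by move=> da db oa ta tb l1 l2; mdeg_solve.
Qed.

Lemma dcomp_idl v a (h : dsrc (didp v) = drng a) : dcomp h = a.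
Proof.
apply: pinv_inj; have h' := dcomp_composable h.
have E := congr1 vinv h; rewrite dsrc_id vinv_drng in E.
have h2 : src (idp (vinv v).1) = rng (plam a) by rewrite src_id E.
have e : plam (didp v) = idp (vinv v).1 by rewrite /plam didp_inv.
rewrite (pinv_dcomp h h') didp_inv add0r E (comp_irr h' h2 e erefl) comp_idl.
by rewrite [RHS]surjective_pairing [(pinv a).1]surjective_pairing.
Qed.

Lemma dcomp_idr v a (h : dsrc a = drng (didp v)) : dcomp h = a.
Proof.
apply: pinv_inj; have h' := dcomp_composable h.
have e : plam (didp v) = idp (vinv v).1 by rewrite /plam didp_inv.
have h2 : src (plam a) = rng (idp (vinv v).1) by rewrite -e.
rewrite (pinv_dcomp h h') didp_inv addr0 (comp_irr h' h2 erefl e) comp_idr.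
by rewrite [RHS]surjective_pairing [(pinv a).1]surjective_pairing.
Qed.

Lemma dcompA a b c (h1 : dsrc a = drng b) (h2 : dsrc b = drng c)
    (h3 : dsrc a = drng (dcomp h2)) (h4 : dsrc (dcomp h1) = drng c) :
  dcomp h3 = dcomp h4.
Proof.
apply: pinv_inj.
have [g1 g2] := (dcomp_composable h1, dcomp_composable h2).
have [g3 g4] := (dcomp_composable h3, dcomp_composable h4).
have e2 : plam (dcomp h2) = kcomp g2 by rewrite /plam (pinv_dcomp h2 g2).
have e1 : plam (dcomp h1) = kcomp g1 by rewrite /plam (pinv_dcomp h1 g1).
rewrite (pinv_dcomp h3 g3) (pinv_dcomp h4 g4).
rewrite (pinv_dcomp h2 g2) (pinv_dcomp h1 g1) /= addrA; congr (_, _, _).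
have k3 : src (plam a) = rng (kcomp g2) by rewrite -e2.
have k4 : src (kcomp g1) = rng (plam c) by rewrite -e1.
by rewrite (comp_irr g3 k3 erefl e2) (comp_irr g4 k4 e1 erefl); apply: kcompA.
Qed.

Lemma ddeg_id v : ddeg (didp v) = 0.
Proof. by rewrite ddegE; mdeg_solve. Qed.

Lemma ddeg_comp a b (h : dsrc a = drng b) : ddeg (dcomp h) = ddeg a + ddeg b.
Proof. by have := congr1 snd (pinv_dcomp h (dcomp_composable h)). Qed.

Lemma dfactorisation l m n : ddeg l = m + n ->
  exists! ab : dpath * dpath,
    [/\ ddeg ab.1 = m, ddeg ab.2 = n
      & exists h : dsrc ab.1 = drng ab.2, dcomp h = l].
Proof.
move=> dl; case: (prep l) (pclassK l) => x u w uw /= El.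
have duw : msub w u = m + n by rewrite -dl -El ddegE.
have h1 : mle u (u + m) by apply: mle_addr.
have h2 : mle (u + m) w by have uw' := uw; mdeg_solve.
have duw' : msub w (u + m) = n by have uw' := uw; mdeg_solve.
exists (pclass x h1, pclass x h2); split=> /=.
  split; [by rewrite ddegE maddK|by rewrite ddegE|].
  have h : dsrc (pclass x h1) = drng (pclass x h2) by rewrite dsrcE drngE.
  exists h; apply: pinv_inj; have h' := dcomp_composable h.
  rewrite (pinv_dcomp h h') -El !pinvE /=; congr (_, _, _); last by rewrite maddK duw' duw.
  have g : src (bseg x h1) = rng (bseg x h2) by rewrite src_bseg rng_bseg.
  by rewrite (comp_irr h' g) ?(comp_bseg uw) // /plam pinvE.
suff U (a b a' b' : dpath) (h : dsrc a = drng b) (h' : dsrc a' = drng b') :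
    ddeg a = ddeg a' -> ddeg b = ddeg b' -> dcomp h = dcomp h' ->
    a = a' /\ b = b'.
  have h : dsrc (pclass x h1) = drng (pclass x h2) by rewrite dsrcE drngE.
  move=> [a b] /= [da db [hab Eab]].
  have [] // := U _ _ _ _ h hab; last by move=> -> ->.
  - by rewrite da ddegE maddK.
  - by rewrite db ddegE.
  rewrite Eab; apply: pinv_inj; have h' := dcomp_composable h.
  rewrite (pinv_dcomp h h') -El !pinvE /=; congr (_, _, _); last by rewrite maddK duw' duw.
  have g : src (bseg x h1) = rng (bseg x h2) by rewrite src_bseg rng_bseg.
  by rewrite (comp_irr h' g) ?(comp_bseg uw) // /plam pinvE.
move=> da db /(congr1 pinv).
have [g g'] := (dcomp_composable h, dcomp_composable h').
rewrite (pinv_dcomp h g) (pinv_dcomp h' g') => -[E ov _].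
have D := congr1 (@deg _ G) E; rewrite !deg_comp in D.
have dla : deg (plam a) = deg (plam a').
  apply/ffunP=> i; rewrite (plam_min i h) (plam_min i h') D.
  by congr minn; move/ffunP/(_ i): da.
have dlb : deg (plam b) = deg (plam b').
  by move: D; rewrite dla; move: (deg (plam b)) => db1; clear; move=> D; mdeg_solve.
have [Ea Eb] := comp_inj dla dlb E.
have Pa : pinv a = pinv a' by congr (_, _, _).
split; first exact: pinv_inj.
apply: pinv_inj; congr (_, _, _) => //.
have := congr1 vinv h; have := congr1 vinv h'.
rewrite !vinv_dsrc !vinv_drng Pa Ea => -[_ <-] [_ <-] //.
Qed.

Definition desourcification : kgraph k :=
  @KGraph k dvert dpath drng dsrc didp dcomp ddeg drng_id dsrc_id drng_comp
    dsrc_comp dcomp_idl dcomp_idr dcompA ddeg_id ddeg_comp dfactorisation.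

Lemma desourcification_row_finite : row_finite G -> row_finite desourcification.
Proof.
move=> rf v n; pose X := [set l | rng l = (vinv v).1 /\ mle (deg l) n].
apply: (@sub_finite_set _ _ (pinv @^-1` ((fun l => (l, (vinv v).2, n)) @` X))).
  move=> l [lv ln]; exists (plam l); last first.
    by rewrite -lv vinv_drng -ln.
  split; first by rewrite -lv vinv_drng.
  by rewrite -ln; apply: plam_le.
apply: finite_preimage; first by move=> ? ? _ _; apply: pinv_inj.
exact/finite_image/finite_mle_paths.
Qed.

End Composition.
End Desourcification.

HB.mixin Record Zmodule_isNURing A of GRing.Zmodule A := {
  numul : A -> A -> A;
  numulA : associative numul;
  numulDl : left_distributive numul +%R;
  numulDr : right_distributive numul +%R
}.
#[short(type="nuRingType")]
HB.structure Definition NURing := {A of GRing.Zmodule A & Zmodule_isNURing A}.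

HB.mixin Record Lmodule_isNUAlgebra (R : comPzRingType) A
    of NURing A & GRing.Lmodule R A := {
  nuscaleAl : forall (a : R) (x y : A), a *: numul x y = numul (a *: x) y;
  nuscaleAr : forall (a : R) (x y : A), a *: numul x y = numul x (a *: y)
}.
#[short(type="nuAlgType")]
HB.structure Definition NUAlgebra (R : comPzRingType) :=
  {A of NURing A & GRing.Lmodule R A & Lmodule_isNUAlgebra R A}.

Notation "x ** y" := (numul x y) (at level 40, left associativity) : ring_scope.

Section KumjianPaskFamily.
Variables (k : nat) (G : kgraph k) (R : comPzRingType).

(* [S l] and [T l] are $S_\lambda$ and $S_{\lambda^*}$; they are defined on all
   paths, and [kp_S_id], [kp_T_id] express the convention on vertices.  In
   [kp4] the sum is taken along any enumeration of $v\Gamma^{\leq n}$, which is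
   finite when $\Gamma$ is row-finite ([finite_bounded_paths]). *)
Record KP_family (A : nuAlgType R)
    (P : kvert G -> A) (S T : kpath G -> A) : Prop := KPFamily {
  kp_S_id : forall v, S (idp v) = P v;
  kp_T_id : forall v, T (idp v) = P v;
  kp1 : forall v w, P v ** P w = if v == w then P v else 0;
  kp2S : forall l m (h : src l = rng m), S l ** S m = S (kcomp h);
  kp2T : forall l m (h : src l = rng m), T m ** T l = T (kcomp h);
  kp2rS : forall l, P (rng l) ** S l = S l;
  kp2Ss : forall l, S l ** P (src l) = S l;
  kp2sT : forall l, P (src l) ** T l = T l;
  kp2Tr : forall l, T l ** P (rng l) = T l;
  kp3 : forall (n : mdeg k) l m, n != 0 -> bounded_paths n l -> bounded_paths n m ->
    T l ** S m = if l == m then P (src l) else 0;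
  kp4 : forall v (n : mdeg k) (s : seq (kpath G)), n != 0 -> uniq s ->
    (forall l, l \in s <-> rng l = v /\ bounded_paths n l) ->
    P v = \sum_(l <- s) S l ** T l
}.

End KumjianPaskFamily.

Section KumjianPask.
Variables (R : comPzRingType) (k : nat) (G : kgraph k).

Inductive kp_term :=
  | KpP of kvert G
  | KpS of kpath G
  | KpT of kpath G
  | Kp0
  | KpAdd of kp_term & kp_term
  | KpOpp of kp_term
  | KpScale of R & kp_term
  | KpMul of kp_term & kp_term.

(* The congruence generated by the axioms of $R$-algebras and the Kumjian-Pask
   relations. *)
Inductive kp_eq : kp_term -> kp_term -> Prop :=
  | KpRefl a : kp_eq a a
  | KpSym a b : kp_eq a b -> kp_eq b a
  | KpTrans a b c : kp_eq a b -> kp_eq b c -> kp_eq a c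
  | KpAddC a a' b b' : kp_eq a a' -> kp_eq b b' -> kp_eq (KpAdd a b) (KpAdd a' b')
  | KpOppC a a' : kp_eq a a' -> kp_eq (KpOpp a) (KpOpp a')
  | KpScaleC r a a' : kp_eq a a' -> kp_eq (KpScale r a) (KpScale r a')
  | KpMulC a a' b b' : kp_eq a a' -> kp_eq b b' -> kp_eq (KpMul a b) (KpMul a' b')
  | KpAddAssoc a b c : kp_eq (KpAdd a (KpAdd b c)) (KpAdd (KpAdd a b) c)
  | KpAddComm a b : kp_eq (KpAdd a b) (KpAdd b a)
  | KpAdd0 a : kp_eq (KpAdd Kp0 a) a
  | KpAddN a : kp_eq (KpAdd (KpOpp a) a) Kp0
  | KpScaleA r s a : kp_eq (KpScale r (KpScale s a)) (KpScale (r * s) a)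
  | KpScale1 a : kp_eq (KpScale 1 a) a
  | KpScaleDr r a b :
      kp_eq (KpScale r (KpAdd a b)) (KpAdd (KpScale r a) (KpScale r b))
  | KpScaleDl r s a :
      kp_eq (KpScale (r + s) a) (KpAdd (KpScale r a) (KpScale s a))
  | KpMulA a b c : kp_eq (KpMul a (KpMul b c)) (KpMul (KpMul a b) c)
  | KpMulDl a b c : kp_eq (KpMul (KpAdd a b) c) (KpAdd (KpMul a c) (KpMul b c))
  | KpMulDr a b c : kp_eq (KpMul a (KpAdd b c)) (KpAdd (KpMul a b) (KpMul a c))
  | KpScaleAl r a b : kp_eq (KpScale r (KpMul a b)) (KpMul (KpScale r a) b)
  | KpScaleAr r a b : kp_eq (KpScale r (KpMul a b)) (KpMul a (KpScale r b))
  | KpSid v : kp_eq (KpS (idp v)) (KpP v)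
  | KpTid v : kp_eq (KpT (idp v)) (KpP v)
  | Kp1 v w : kp_eq (KpMul (KpP v) (KpP w)) (if v == w then KpP v else Kp0)
  | Kp2S l m (h : src l = rng m) : kp_eq (KpMul (KpS l) (KpS m)) (KpS (kcomp h))
  | Kp2T l m (h : src l = rng m) : kp_eq (KpMul (KpT m) (KpT l)) (KpT (kcomp h))
  | Kp2rS l : kp_eq (KpMul (KpP (rng l)) (KpS l)) (KpS l)
  | Kp2Ss l : kp_eq (KpMul (KpS l) (KpP (src l))) (KpS l)
  | Kp2sT l : kp_eq (KpMul (KpP (src l)) (KpT l)) (KpT l)
  | Kp2Tr l : kp_eq (KpMul (KpT l) (KpP (rng l))) (KpT l)
  | Kp3 (n : mdeg k) l m : n != 0 -> bounded_paths n l -> bounded_paths n m ->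
      kp_eq (KpMul (KpT l) (KpS m)) (if l == m then KpP (src l) else Kp0)
  | Kp4 v (n : mdeg k) (s : seq (kpath G)) : n != 0 -> uniq s ->
      (forall l, l \in s <-> rng l = v /\ bounded_paths n l) ->
      kp_eq (KpP v) (foldr (fun l => KpAdd (KpMul (KpS l) (KpT l))) Kp0 s).

Definition kp_rel : rel {classic kp_term} := fun a b => `[< kp_eq a b >].

Fact kp_rel_refl : reflexive kp_rel.
Proof. by move=> a; apply/asboolP; apply: KpRefl. Qed.
Fact kp_rel_sym : symmetric kp_rel.
Proof. by move=> a b; apply/asboolP/asboolP; apply: KpSym. Qed.
Fact kp_rel_trans : transitive kp_rel.
Proof. by move=> b a c /asboolP ab /asboolP bc; apply/asboolP; apply: KpTrans bc. Qed.
Canonical kp_equiv := EquivRel kp_rel kp_rel_refl kp_rel_sym kp_rel_trans.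

(* $\mathrm{KP}_R(\Gamma)$ *)
Definition KP := {eq_quot kp_equiv}.
HB.instance Definition _ := Choice.on KP.
HB.instance Definition _ := Quotient.on KP.

Definition kp_class (a : kp_term) : KP := \pi_KP (a : {classic kp_term}).

Lemma kp_classP a b : kp_class a = kp_class b <-> kp_eq a b.
Proof. by split=> [/eqmodP/asboolP//|h]; apply/eqmodP/asboolP. Qed.

Definition kp_repr (x : KP) : kp_term := repr x.
Lemma kp_reprK x : kp_class (kp_repr x) = x. Proof. exact: reprK. Qed.
Lemma kp_repr_class a : kp_eq (kp_repr (kp_class a)) a.
Proof. by apply/kp_classP; rewrite kp_reprK. Qed.

Definition kp_add (x y : KP) := kp_class (KpAdd (kp_repr x) (kp_repr y)).
Definition kp_opp (x : KP) := kp_class (KpOpp (kp_repr x)).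
Definition kp_scale (r : R) (x : KP) := kp_class (KpScale r (kp_repr x)).
Definition kp_mul (x y : KP) := kp_class (KpMul (kp_repr x) (kp_repr y)).

Lemma kp_addE a b : kp_add (kp_class a) (kp_class b) = kp_class (KpAdd a b).
Proof. by apply/kp_classP; apply: KpAddC; apply: kp_repr_class. Qed.
Lemma kp_oppE a : kp_opp (kp_class a) = kp_class (KpOpp a).
Proof. by apply/kp_classP; apply: KpOppC; apply: kp_repr_class. Qed.
Lemma kp_scaleE r a : kp_scale r (kp_class a) = kp_class (KpScale r a).
Proof. by apply/kp_classP; apply: KpScaleC; apply: kp_repr_class. Qed.
Lemma kp_mulE a b : kp_mul (kp_class a) (kp_class b) = kp_class (KpMul a b).
Proof. by apply/kp_classP; apply: KpMulC; apply: kp_repr_class. Qed.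

Definition kp_opE := (kp_addE, kp_oppE, kp_scaleE, kp_mulE).

Fact kp_addA : associative kp_add.
Proof.
move=> x y z; rewrite -(kp_reprK x) -(kp_reprK y) -(kp_reprK z) !kp_opE.
by apply/kp_classP/KpAddAssoc.
Qed.
Fact kp_addC : commutative kp_add.
Proof.
move=> x y; rewrite -(kp_reprK x) -(kp_reprK y) !kp_opE.
by apply/kp_classP/KpAddComm.
Qed.
Fact kp_add0 : left_id (kp_class Kp0) kp_add.
Proof. by move=> x; rewrite -(kp_reprK x) !kp_opE; apply/kp_classP/KpAdd0. Qed.
Fact kp_addN : left_inverse (kp_class Kp0) kp_opp kp_add.
Proof. by move=> x; rewrite -(kp_reprK x) !kp_opE; apply/kp_classP/KpAddN. Qed.

HB.instance Definition _ :=
  GRing.isZmodule.Build KP kp_addA kp_addC kp_add0 kp_addN.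

Fact kp_scaleA r s x : kp_scale r (kp_scale s x) = kp_scale (r * s) x.
Proof. by rewrite -(kp_reprK x) !kp_opE; apply/kp_classP/KpScaleA. Qed.
Fact kp_scale1 : left_id 1 kp_scale.
Proof. by move=> x; rewrite -(kp_reprK x) !kp_opE; apply/kp_classP/KpScale1. Qed.
Fact kp_scaleDr : right_distributive kp_scale +%R.
Proof.
move=> r x y; rewrite -(kp_reprK x) -(kp_reprK y) /GRing.add /= !kp_opE.
by apply/kp_classP/KpScaleDr.
Qed.
Fact kp_scaleDl x : {morph kp_scale^~ x : r s / r + s}.
Proof.
move=> r s; rewrite -(kp_reprK x) /= !kp_opE [RHS]kp_addE.
by apply/kp_classP/KpScaleDl.
Qed.

HB.instance Definition _ := GRing.Zmodule_isLmodule.Build R KP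
  kp_scaleA kp_scale1 kp_scaleDr kp_scaleDl.

Fact kp_mulA : associative kp_mul.
Proof.
move=> x y z; rewrite -(kp_reprK x) -(kp_reprK y) -(kp_reprK z) !kp_opE.
by apply/kp_classP/KpMulA.
Qed.
Fact kp_mulDl : left_distributive kp_mul +%R.
Proof.
move=> x y z; rewrite -(kp_reprK x) -(kp_reprK y) -(kp_reprK z).
rewrite [_ + _]kp_addE !kp_mulE [RHS]kp_addE.
by apply/kp_classP/KpMulDl.
Qed.
Fact kp_mulDr : right_distributive kp_mul +%R.
Proof.
move=> x y z; rewrite -(kp_reprK x) -(kp_reprK y) -(kp_reprK z).
rewrite [_ + _]kp_addE !kp_mulE [RHS]kp_addE.
by apply/kp_classP/KpMulDr.
Qed.

HB.instance Definition _ := Zmodule_isNURing.Build KP kp_mulA kp_mulDl kp_mulDr.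

Fact kp_scaleAl (r : R) (x y : KP) : r *: (x ** y) = (r *: x) ** y.
Proof.
rewrite -(kp_reprK x) -(kp_reprK y) [_ ** _]kp_mulE [_ *: kp_class (kp_repr x)]kp_scaleE.
by rewrite [LHS]kp_scaleE [RHS]kp_mulE; apply/kp_classP/KpScaleAl.
Qed.
Fact kp_scaleAr (r : R) (x y : KP) : r *: (x ** y) = x ** (r *: y).
Proof.
rewrite -(kp_reprK x) -(kp_reprK y) [_ ** _]kp_mulE [_ *: kp_class (kp_repr y)]kp_scaleE.
by rewrite [LHS]kp_scaleE [RHS]kp_mulE; apply/kp_classP/KpScaleAr.
Qed.

HB.instance Definition _ := Lmodule_isNUAlgebra.Build R KP kp_scaleAl kp_scaleAr.

Definition kpP v : KP := kp_class (KpP v).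
Definition kpS l : KP := kp_class (KpS l).
Definition kpT l : KP := kp_class (KpT l).

Lemma KP_family_KP : KP_family kpP kpS kpT.
Proof.
split.
- by move=> v; apply/kp_classP/KpSid.
- by move=> v; apply/kp_classP/KpTid.
- move=> v w; rewrite [LHS]kp_mulE.
  have -> : (if v == w then kpP v else 0) = kp_class (if v == w then KpP v else Kp0).
    by case: eqP.
  by apply/kp_classP/Kp1.
- by move=> l m h; rewrite [LHS]kp_mulE; apply/kp_classP/Kp2S.
- by move=> l m h; rewrite [LHS]kp_mulE; apply/kp_classP/Kp2T.
- by move=> l; rewrite [LHS]kp_mulE; apply/kp_classP/Kp2rS.
- by move=> l; rewrite [LHS]kp_mulE; apply/kp_classP/Kp2Ss.
- by move=> l; rewrite [LHS]kp_mulE; apply/kp_classP/Kp2sT.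
- by move=> l; rewrite [LHS]kp_mulE; apply/kp_classP/Kp2Tr.
- move=> n l m n0 hl hm; rewrite [LHS]kp_mulE.
  have -> : (if l == m then kpP (src l) else 0) =
      kp_class (if l == m then KpP (src l) else Kp0) by case: eqP.
  by apply/kp_classP/(Kp3 n0).
- move=> v n s n0 us hs; transitivity
    (kp_class (foldr (fun l => KpAdd (KpMul (KpS l) (KpT l))) Kp0 s)).
    by apply/kp_classP/(Kp4 n0).
  elim: s {us hs} => [|l s IHs] /=; first by rewrite big_nil.
  by rewrite big_cons -IHs [_ ** _]kp_mulE [RHS]kp_addE.
Qed.

Section Universal.
Variables (A : nuAlgType R) (P : kvert G -> A) (S T : kpath G -> A).
Hypothesis PST : KP_family P S T.

Fixpoint kp_eval (a : kp_term) : A :=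
  match a with
  | KpP v => P v
  | KpS l => S l
  | KpT l => T l
  | Kp0 => 0
  | KpAdd a b => kp_eval a + kp_eval b
  | KpOpp a => - kp_eval a
  | KpScale r a => r *: kp_eval a
  | KpMul a b => kp_eval a ** kp_eval b
  end.

Lemma kp_eval_eq a b : kp_eq a b -> kp_eval a = kp_eval b.
Proof.
have [h1 h2 h3 h4 h5 h6 h7 h8 h9 h10 h11] := PST.
elim=> //=; try by move=> *; congruence.
- by move=> *; rewrite addrA.
- by move=> *; rewrite addrC.
- by move=> *; rewrite add0r.
- by move=> *; rewrite addNr.
- by move=> *; rewrite scalerA.
- by move=> *; rewrite scale1r.
- by move=> *; rewrite scalerDr.
- by move=> r s c; rewrite scalerDl.
- by move=> *; rewrite numulA.
- by move=> *; rewrite numulDl.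
- by move=> *; rewrite numulDr.
- by move=> *; rewrite nuscaleAl.
- by move=> *; rewrite nuscaleAr.
- by move=> v w; rewrite h3; case: eqP.
- by move=> n l m n0 hl hm; rewrite (h10 n) //; case: eqP.
- move=> v n s n0 us hs; rewrite (h11 v n s) //.
  elim: s {us hs} => [|l s IHs] /=; first by rewrite big_nil.
  by rewrite big_cons IHs.
Qed.

Definition kp_lift (x : KP) : A := kp_eval (kp_repr x).

Lemma kp_liftE a : kp_lift (kp_class a) = kp_eval a.
Proof. exact/kp_eval_eq/kp_repr_class. Qed.

End Universal.

Lemma KP_universal (A : nuAlgType R) (P : kvert G -> A) (S T : kpath G -> A) :
  KP_family P S T ->
  exists! f : KP -> A,
    [/\ linear f, {morph f : x y / x ** y},
        forall v, f (kpP v) = P v, forall l, f (kpS l) = S l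
      & forall l, f (kpT l) = T l].
Proof.
move=> PST; exists (kp_lift P S T); split.
  split; try by move=> z; rewrite kp_liftE.
  - move=> r x y; rewrite -(kp_reprK x) -(kp_reprK y).
    by rewrite [_ *: _]kp_scaleE [_ + _]kp_addE !kp_liftE.
  - by move=> x y; rewrite -(kp_reprK x) -(kp_reprK y) [_ ** _]kp_mulE !kp_liftE.
move=> f [flin fM fP fS fT]; apply/funext => x.
have f0 : f 0 = 0.
  by have := flin (-1) 0 0; rewrite scaler0 addr0 scaleN1r addNr.
have fD x1 x2 : f (x1 + x2) = f x1 + f x2.
  by have := flin 1 x1 x2; rewrite !scale1r.
have fZ r x1 : f (r *: x1) = r *: f x1.
  by have := flin r x1 0; rewrite f0 !addr0.
rewrite -(kp_reprK x) kp_liftE //; elim: (kp_repr x) => /=.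
- by move=> v; rewrite -fP.
- by move=> l; rewrite -fS.
- by move=> l; rewrite -fT.
- by rewrite -f0.
- by move=> a IHa b IHb; rewrite IHa IHb -fD [_ + _]kp_addE.
- move=> a IHa; rewrite IHa -kp_oppE -[kp_opp _]/(- kp_class a).
  by rewrite -[in RHS]scaleN1r fZ scaleN1r.
- by move=> r a IHa; rewrite IHa -fZ [_ *: _]kp_scaleE.
- by move=> a IHa b IHb; rewrite IHa IHb -fM [_ ** _]kp_mulE.
Qed.

End KumjianPask.

(* Bimodules over non-unital rings; no unit acts, so no unitality is required. *)
Record bimodule (A B : nuRingType) := Bimodule {
  bim_car :> zmodType;
  lact : A -> bim_car -> bim_car;
  ract : bim_car -> B -> bim_car;
  lactDl : forall a a' m, lact (a + a') m = lact a m + lact a' m;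
  lactDr : forall a m m', lact a (m + m') = lact a m + lact a m';
  lactM : forall a a' m, lact (a ** a') m = lact a (lact a' m);
  ractDl : forall m m' b, ract (m + m') b = ract m b + ract m' b;
  ractDr : forall m b b', ract m (b + b') = ract m b + ract m b';
  ractM : forall m b b', ract m (b ** b') = ract (ract m b) b';
  lract : forall a m b, ract (lact a m) b = lact a (ract m b)
}.

Record bimodule_hom (A B : nuRingType) (M N : bimodule A B) := BimoduleHom {
  bhom :> M -> N;
  bhomD : forall m m', bhom (m + m') = bhom m + bhom m';
  bhomL : forall a m, bhom (lact a m) = lact a (bhom m);
  bhomR : forall m b, bhom (ract m b) = ract (bhom m) b
}.

(* $A$ as an $A$--$A$ bimodule *)
Definition regular_bimodule (A : nuRingType) : bimodule A A :=
  @Bimodule A A A (@numul A) (@numul A)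
    (fun a a' m => numulDl a a' m) (fun a m m' => numulDr a m m')
    (fun a a' m => esym (numulA a a' m)) (fun m m' b => numulDl m m' b)
    (fun m b b' => numulDr m b b') (fun m b b' => numulA m b b')
    (fun a m b => esym (numulA a m b)).

Section Tensor.
Variables (A B C : nuRingType) (M : bimodule A B) (N : bimodule B C).

Inductive tens_term :=
  | TensPure of M & N
  | Tens0
  | TensAdd of tens_term & tens_term
  | TensOpp of tens_term.

(* The congruence generated by the axioms of abelian groups, biadditivity and
   $mb\otimes n=m\otimes bn$ for $b\in B$. *)
Inductive tens_eq : tens_term -> tens_term -> Prop :=
  | TensRefl t : tens_eq t t
  | TensSym t u : tens_eq t u -> tens_eq u t
  | TensTrans t u w : tens_eq t u -> tens_eq u w -> tens_eq t w
  | TensAddC t t' u u' :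
      tens_eq t t' -> tens_eq u u' -> tens_eq (TensAdd t u) (TensAdd t' u')
  | TensOppC t t' : tens_eq t t' -> tens_eq (TensOpp t) (TensOpp t')
  | TensAddAssoc t u w :
      tens_eq (TensAdd t (TensAdd u w)) (TensAdd (TensAdd t u) w)
  | TensAddComm t u : tens_eq (TensAdd t u) (TensAdd u t)
  | TensAdd0 t : tens_eq (TensAdd Tens0 t) t
  | TensAddN t : tens_eq (TensAdd (TensOpp t) t) Tens0
  | TensDl m m' n :
      tens_eq (TensPure (m + m') n) (TensAdd (TensPure m n) (TensPure m' n))
  | TensDr m n n' :
      tens_eq (TensPure m (n + n')) (TensAdd (TensPure m n) (TensPure m n'))
  | TensBal m b n : tens_eq (TensPure (ract m b) n) (TensPure m (lact b n)).

Definition tens_rel : rel {classic tens_term} := fun t u => `[< tens_eq t u >].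

Fact tens_rel_refl : reflexive tens_rel.
Proof. by move=> t; apply/asboolP; apply: TensRefl. Qed.
Fact tens_rel_sym : symmetric tens_rel.
Proof. by move=> t u; apply/asboolP/asboolP; apply: TensSym. Qed.
Fact tens_rel_trans : transitive tens_rel.
Proof. by move=> u t w /asboolP tu /asboolP uw; apply/asboolP; apply: TensTrans uw. Qed.
Canonical tens_equiv := EquivRel tens_rel tens_rel_refl tens_rel_sym tens_rel_trans.

Definition tens_car := {eq_quot tens_equiv}.
HB.instance Definition _ := Choice.on tens_car.
HB.instance Definition _ := Quotient.on tens_car.

Definition tens_class (t : tens_term) : tens_car :=
  \pi_tens_car (t : {classic tens_term}).
Definition tens_repr (x : tens_car) : tens_term := repr x.

Lemma tens_classP t u : tens_class t = tens_class u <-> tens_eq t u.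
Proof. by split=> [/eqmodP/asboolP//|h]; apply/eqmodP/asboolP. Qed.
Lemma tens_reprK x : tens_class (tens_repr x) = x. Proof. exact: reprK. Qed.
Lemma tens_repr_class t : tens_eq (tens_repr (tens_class t)) t.
Proof. by apply/tens_classP; rewrite tens_reprK. Qed.

Definition tens_add (x y : tens_car) :=
  tens_class (TensAdd (tens_repr x) (tens_repr y)).
Definition tens_opp (x : tens_car) := tens_class (TensOpp (tens_repr x)).

Lemma tens_addE t u : tens_add (tens_class t) (tens_class u) = tens_class (TensAdd t u).
Proof. by apply/tens_classP; apply: TensAddC; apply: tens_repr_class. Qed.
Lemma tens_oppE t : tens_opp (tens_class t) = tens_class (TensOpp t).
Proof. by apply/tens_classP; apply: TensOppC; apply: tens_repr_class. Qed.

Fact tens_addA : associative tens_add.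
Proof.
move=> x y z; rewrite -(tens_reprK x) -(tens_reprK y) -(tens_reprK z) !tens_addE.
by apply/tens_classP/TensAddAssoc.
Qed.
Fact tens_addC : commutative tens_add.
Proof.
move=> x y; rewrite -(tens_reprK x) -(tens_reprK y) !tens_addE.
by apply/tens_classP/TensAddComm.
Qed.
Fact tens_add0 : left_id (tens_class Tens0) tens_add.
Proof. by move=> x; rewrite -(tens_reprK x) tens_addE; apply/tens_classP/TensAdd0. Qed.
Fact tens_addN : left_inverse (tens_class Tens0) tens_opp tens_add.
Proof.
move=> x; rewrite -(tens_reprK x) tens_oppE tens_addE.
by apply/tens_classP/TensAddN.
Qed.

HB.instance Definition _ :=
  GRing.isZmodule.Build tens_car tens_addA tens_addC tens_add0 tens_addN.

(* $m\otimes n$ *)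
Definition tens (m : M) (n : N) : tens_car := tens_class (TensPure m n).

Lemma tens_DE t u : tens_class t + tens_class u = tens_class (TensAdd t u).
Proof. exact: tens_addE. Qed.
Lemma tens_NE t : - tens_class t = tens_class (TensOpp t).
Proof. exact: tens_oppE. Qed.

Lemma tensDl m m' n : tens (m + m') n = tens m n + tens m' n.
Proof. by rewrite tens_DE; apply/tens_classP/TensDl. Qed.
Lemma tensDr m n n' : tens m (n + n') = tens m n + tens m n'.
Proof. by rewrite tens_DE; apply/tens_classP/TensDr. Qed.
Lemma tens_bal m b n : tens (ract m b) n = tens m (lact b n).
Proof. exact/tens_classP/TensBal. Qed.

Lemma tens_ind (Q : tens_car -> Prop) :
  (forall m n, Q (tens m n)) -> Q 0 -> (forall x y, Q x -> Q y -> Q (x + y)) ->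
  (forall x, Q x -> Q (- x)) -> forall x, Q x.
Proof.
move=> Qp Q0 QD QN x; rewrite -(tens_reprK x).
elim: (tens_repr x) => [m n||t IHt u IHu|t IHt].
- exact: Qp.
- exact: Q0.
- by rewrite -tens_DE; apply: QD.
- by rewrite -tens_NE; apply: QN.
Qed.

Section Lift.
Variables (V : zmodType) (f : M -> N -> V).
Hypothesis fDl : forall m m' n, f (m + m') n = f m n + f m' n.
Hypothesis fDr : forall m n n', f m (n + n') = f m n + f m n'.
Hypothesis f_bal : forall m b n, f (ract m b) n = f m (lact b n).

Fixpoint tens_eval (t : tens_term) : V :=
  match t with
  | TensPure m n => f m n
  | Tens0 => 0
  | TensAdd t u => tens_eval t + tens_eval u
  | TensOpp t => - tens_eval t
  end.

Lemma tens_eval_eq t u : tens_eq t u -> tens_eval t = tens_eval u.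
Proof.
elim=> //=; try by move=> *; congruence.
- by move=> *; rewrite addrA.
- by move=> *; rewrite addrC.
- by move=> *; rewrite add0r.
- by move=> *; rewrite addNr.
Qed.

Definition tens_lift (x : tens_car) : V := tens_eval (tens_repr x).

Lemma tens_lift_class t : tens_lift (tens_class t) = tens_eval t.
Proof. exact/tens_eval_eq/tens_repr_class. Qed.

Lemma tens_liftE m n : tens_lift (tens m n) = f m n.
Proof. exact: tens_lift_class. Qed.

Lemma tens_liftD x y : tens_lift (x + y) = tens_lift x + tens_lift y.
Proof.
by rewrite -(tens_reprK x) -(tens_reprK y) tens_DE !tens_lift_class.
Qed.

End Lift.

Section Actions.

Fact tens_lact_Dl (a : A) m m' n :
  tens (lact a (m + m')) n = tens (lact a m) n + tens (lact a m') n.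
Proof. by rewrite lactDr tensDl. Qed.
Fact tens_lact_Dr (a : A) m n n' :
  tens (lact a m) (n + n') = tens (lact a m) n + tens (lact a m) n'.
Proof. exact: tensDr. Qed.
Fact tens_lact_bal (a : A) m b n :
  tens (lact a (ract m b)) n = tens (lact a m) (lact b n).
Proof. by rewrite -lract tens_bal. Qed.
Fact tens_ract_Dl (c : C) m m' n :
  tens (m + m') (ract n c) = tens m (ract n c) + tens m' (ract n c).
Proof. exact: tensDl. Qed.
Fact tens_ract_Dr (c : C) m n n' :
  tens m (ract (n + n') c) = tens m (ract n c) + tens m (ract n' c).
Proof. by rewrite ractDl tensDr. Qed.
Fact tens_ract_bal (c : C) m b n :
  tens (ract m b) (ract n c) = tens m (ract (lact b n) c).
Proof. by rewrite lract tens_bal. Qed.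

(* $a(m\otimes n)=am\otimes n$ *)
Definition tens_lact (a : A) : tens_car -> tens_car :=
  tens_lift (fun m n => tens (lact a m) n).
(* $(m\otimes n)c=m\otimes nc$ *)
Definition tens_ract (x : tens_car) (c : C) : tens_car :=
  tens_lift (fun m n => tens m (ract n c)) x.

Lemma tens_lactE a m n : tens_lact a (tens m n) = tens (lact a m) n.
Proof.
exact: (tens_liftE (tens_lact_Dl a) (tens_lact_Dr a) (tens_lact_bal a)).
Qed.
Lemma tens_lactD a x y : tens_lact a (x + y) = tens_lact a x + tens_lact a y.
Proof.
exact: (tens_liftD (tens_lact_Dl a) (tens_lact_Dr a) (tens_lact_bal a)).
Qed.
Lemma tens_ractE m n c : tens_ract (tens m n) c = tens m (ract n c).
Proof.
exact: (tens_liftE (tens_ract_Dl c) (tens_ract_Dr c) (tens_ract_bal c)).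
Qed.
Lemma tens_ractD x y c : tens_ract (x + y) c = tens_ract x c + tens_ract y c.
Proof.
exact: (tens_liftD (tens_ract_Dl c) (tens_ract_Dr c) (tens_ract_bal c)).
Qed.

Lemma tens_additive_eq (V : zmodType) (f g : tens_car -> V) :
  {morph f : x y / x + y} -> {morph g : x y / x + y} ->
  (forall m n, f (tens m n) = g (tens m n)) -> f =1 g.
Proof.
move=> fD gD e.
have h0 (h : tens_car -> V) : {morph h : x y / x + y} -> h 0 = 0.
  by move=> hD; apply: (addrI (h 0)); rewrite -hD !addr0.
have hN (h : tens_car -> V) x : {morph h : x y / x + y} -> h (- x) = - h x.
  by move=> hD; apply/eqP; rewrite -addr_eq0 -hD addNr h0.
elim/tens_ind=> // [|x y ex ey|x ex]; first by rewrite !h0.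
- by rewrite fD gD ex ey.
- by rewrite !hN // ex.
Qed.

Fact tens_lactDl a a' x : tens_lact (a + a') x = tens_lact a x + tens_lact a' x.
Proof.
apply: (tens_additive_eq (f := tens_lact (a + a'))
  (g := fun x => tens_lact a x + tens_lact a' x)) => [u v|u v|m n] /=.
- exact: tens_lactD.
- by rewrite !tens_lactD addrACA.
- by rewrite !tens_lactE lactDl tensDl.
Qed.
Fact tens_lactM a a' x : tens_lact (a ** a') x = tens_lact a (tens_lact a' x).
Proof.
apply: (tens_additive_eq (f := tens_lact (a ** a'))
  (g := fun x => tens_lact a (tens_lact a' x))) => [u v|u v|m n] /=.
- exact: tens_lactD.
- by rewrite !tens_lactD.
- by rewrite !tens_lactE lactM.
Qed.
Fact tens_ractDr x c c' : tens_ract x (c + c') = tens_ract x c + tens_ract x c'.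
Proof.
apply: (tens_additive_eq (f := tens_ract^~ (c + c'))
  (g := fun x => tens_ract x c + tens_ract x c')) => [u v|u v|m n] /=.
- exact: tens_ractD.
- by rewrite !tens_ractD addrACA.
- by rewrite !tens_ractE ractDr tensDr.
Qed.
Fact tens_ractM x c c' : tens_ract x (c ** c') = tens_ract (tens_ract x c) c'.
Proof.
apply: (tens_additive_eq (f := tens_ract^~ (c ** c'))
  (g := fun x => tens_ract (tens_ract x c) c')) => [u v|u v|m n] /=.
- exact: tens_ractD.
- by rewrite !tens_ractD.
- by rewrite !tens_ractE ractM.
Qed.
Fact tens_lract a x c : tens_ract (tens_lact a x) c = tens_lact a (tens_ract x c).
Proof.
apply: (tens_additive_eq (f := fun x => tens_ract (tens_lact a x) c)
  (g := fun x => tens_lact a (tens_ract x c))) => [u v|u v|m n] /=.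
- by rewrite tens_lactD tens_ractD.
- by rewrite tens_ractD tens_lactD.
- by rewrite tens_lactE !tens_ractE tens_lactE.
Qed.

End Actions.

(* $M\otimes_B N$ as an $A$--$C$ bimodule *)
Definition tensor : bimodule A C :=
  @Bimodule A C tens_car tens_lact tens_ract tens_lactDl tens_lactD tens_lactM
    tens_ractD tens_ractDr tens_ractM tens_lract.

End Tensor.

Record morita_context (A B : nuRingType) := MoritaContext {
  mctx_M : bimodule A B;
  mctx_N : bimodule B A;
  mctx_psi : bimodule_hom (tensor mctx_M mctx_N) (regular_bimodule A);
  mctx_phi : bimodule_hom (tensor mctx_N mctx_M) (regular_bimodule B);
  mctx_psi_phi : forall (m : mctx_M) (n n' : mctx_N),
    ract n' (mctx_psi (tens m n)) = lact (mctx_phi (tens n' m)) n;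
  mctx_phi_psi : forall (m m' : mctx_M) (n : mctx_N),
    ract m' (mctx_phi (tens n m)) = lact (mctx_psi (tens m' n)) m
}.

Definition surjective_morita (A B : nuRingType) (X : morita_context A B) : Prop :=
  (forall a, exists t, mctx_psi X t = a) /\ (forall b, exists t, mctx_phi X t = b).

(* Main.v *)
(** Write [D] for the desourcification of [L].  Its paths correspond to triples
    [(l, t, n)] with [l] in [L^{<= n}] and [r(l) L^{e_i}] empty whenever
    [t_i > 0]; this uses that every vertex is the range of a boundary path.
    Hence [L] embeds in [D] as the triples [(l, 0, d(l))], and every vertex [w]
    of [D] is joined to a vertex of [L] by a path [tail w] which is the only one
    of its degree leaving that vertex, so that [S_(tail w)] is invertible up to
    vertex projections.  The embedding induces [f : KP(L) -> KP(D)], and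
    [KP(D)] is spanned by the [T_(tail w) f(x) S_(tail w')]; therefore the image
    of [f] is a full corner.  Injectivity of [f] does not need a graded
    uniqueness theorem: [KP(D)] acts on functions from the vertices of [D] to
    [KP(L)], and this action turns [f(x)] into left multiplication by [x]. *)

Require Import Defs.
From HB Require Import structures.
From mathcomp Require Import all_boot all_order all_algebra.
From mathcomp Require Import boolp classical_sets cardinality.
From mathcomp Require Import zify.

Set Implicit Arguments.
Unset Strict Implicit.
Unset Printing Implicit Defensive.

Import GRing.Theory.
Local Open Scope ring_scope.
Local Open Scope classical_set_scope.

(** * Morita contexts from full corners *)

Section AdditiveSpan.
Variable V : zmodType.

Inductive add_span (Q : V -> Prop) : V -> Prop :=
  | span_gen x : Q x -> add_span Q x
  | span0 : add_span Q 0
  | spanD x y : add_span Q x -> add_span Q y -> add_span Q (x + y)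
  | spanN x : add_span Q x -> add_span Q (- x).

(** A [{pred V}] version of [add_span], so that the generated subgroup becomes a subtype with its
    own [zmodType] structure and can carry a bimodule. *)
Definition spanp (Q : V -> Prop) : {pred V} := fun x => `[< add_span Q x >].

Fact spanp_closed Q : zmod_closed (spanp Q).
Proof.
split=> [|x y /asboolP hx /asboolP hy]; apply/asboolP; first exact: span0.
by apply: spanD => //; apply: spanN.
Qed.
HB.instance Definition _ Q := GRing.isZmodClosed.Build V (spanp Q) (spanp_closed Q).

Record span_type (Q : V -> Prop) := SpanType {
  span_val : V;
  span_valP : span_val \in spanp Q
}.
HB.instance Definition _ Q := [isSub for @span_val Q].
HB.instance Definition _ Q := [Choice of span_type Q by <:].
HB.instance Definition _ Q := [SubChoice_isSubZmodule of span_type Q by <:].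

End AdditiveSpan.

(** * Ring identities without a unit *)

Lemma numul0 (A : nuRingType) (x : A) : x ** 0 = 0.
Proof. by apply: (addrI (x ** 0)); rewrite -numulDr !addr0. Qed.
Lemma nu0mul (A : nuRingType) (x : A) : 0 ** x = 0.
Proof. by apply: (addrI (0 ** x)); rewrite -numulDl !addr0. Qed.
Lemma numulN (A : nuRingType) (x y : A) : x ** (- y) = - (x ** y).
Proof. by apply/eqP; rewrite -addr_eq0 -numulDr addNr numul0. Qed.
Lemma nuNmul (A : nuRingType) (x y : A) : (- x) ** y = - (x ** y).
Proof. by apply/eqP; rewrite -addr_eq0 -numulDl addNr nu0mul. Qed.
Lemma numul_sumr (A : nuRingType) (I : Type) (s : seq I) (x : A) (F : I -> A) :
  x ** (\sum_(i <- s) F i) = \sum_(i <- s) x ** F i.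
Proof. by apply: (big_morph (numul x)); [exact: numulDr|exact: numul0]. Qed.
Lemma numul_suml (A : nuRingType) (I : Type) (s : seq I) (x : A) (F : I -> A) :
  (\sum_(i <- s) F i) ** x = \sum_(i <- s) F i ** x.
Proof. by apply: (big_morph (numul^~ x)) => [a b|]; [exact: numulDl|exact: nu0mul]. Qed.

Section FullCorner.
Variables (A B : nuRingType) (f : B -> A).
Hypothesis fD : {morph f : x y / x + y}.
Hypothesis fM : {morph f : x y / x ** y}.
Hypothesis f_inj : injective f.
(** With no unit at hand, [f B] takes the place of a corner [e A e]: [f B A f B] lies in [f B], and
    by [full] the products [A f B A] span [A]. *)
Hypothesis corner : forall b a b', exists c, f b ** a ** f b' = f c.
Hypothesis full : forall a,
  add_span (fun x => exists a1 b a2, x = a1 ** f b ** a2) a.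
Hypothesis idem : forall b : B, add_span (fun x => exists b1 b2, x = b1 ** b2) b.

Let AB := span_type (fun x => exists a b, x = a ** f b).
Let BA := span_type (fun x => exists b a, x = f b ** a).

Let f0 : f 0 = 0.
Proof. by apply: (addrI (f 0)); rewrite -fD !addr0. Qed.
Let fN b : f (- b) = - f b.
Proof. by apply/eqP; rewrite -addr_eq0 -fD addNr f0. Qed.

Fact AB_lact_subproof a (m : AB) :
  a ** val m \in spanp (fun x => exists a b, x = a ** f b).
Proof.
apply/asboolP; case: m => x /= /asboolP; elim=> [y [a' [b ->]]||y z _ hy _ hz|y _ hy].
- by apply: span_gen; exists (a ** a'), b; rewrite numulA.
- by rewrite numul0; apply: span0.
- by rewrite numulDr; apply: spanD.
- by rewrite numulN; apply: spanN.
Qed.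
Definition AB_lact a (m : AB) : AB := SpanType (AB_lact_subproof a m).

Fact AB_ract_subproof (m : AB) b :
  val m ** f b \in spanp (fun x => exists a b, x = a ** f b).
Proof. by apply/asboolP/span_gen; exists (val m), b. Qed.
Definition AB_ract (m : AB) b : AB := SpanType (AB_ract_subproof m b).

Fact BA_ract_subproof (n : BA) a :
  val n ** a \in spanp (fun x => exists b a, x = f b ** a).
Proof.
apply/asboolP; case: n => x /= /asboolP; elim=> [y [b [a' ->]]||y z _ hy _ hz|y _ hy].
- by apply: span_gen; exists b, (a' ** a); rewrite numulA.
- by rewrite nu0mul; apply: span0.
- by rewrite numulDl; apply: spanD.
- by rewrite nuNmul; apply: spanN.
Qed.
Definition BA_ract (n : BA) a : BA := SpanType (BA_ract_subproof n a).

Fact BA_lact_subproof b (n : BA) :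
  f b ** val n \in spanp (fun x => exists b a, x = f b ** a).
Proof. by apply/asboolP/span_gen; exists b, (val n). Qed.
Definition BA_lact b (n : BA) : BA := SpanType (BA_lact_subproof b n).

Definition AB_bimodule : bimodule A B.
Proof.
refine (@Bimodule A B AB AB_lact AB_ract _ _ _ _ _ _ _);
  move=> *; apply: val_inj; rewrite /= ?raddfD /= ?(fD, fM) //.
all: by rewrite ?(numulDl, numulDr, numulA).
Defined.

Definition BA_bimodule : bimodule B A.
Proof.
refine (@Bimodule B A BA BA_lact BA_ract _ _ _ _ _ _ _);
  move=> *; apply: val_inj; rewrite /= ?raddfD /= ?(fD, fM) //.
all: by rewrite ?(numulDl, numulDr, numulA).
Defined.

(** By biadditivity the product reduces to [f b ** (a ** a') ** f b'], to which [corner] applies. *)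
Lemma BA_AB_image (n : BA) (m : AB) : exists b, f b = val n ** val m.
Proof.
have add x y : (exists b, f b = x) -> (exists b, f b = y) -> exists b, f b = x + y.
  by move=> [b <-] [c <-]; exists (b + c).
have opp x : (exists b, f b = x) -> exists b, f b = - x.
  by move=> [b <-]; exists (- b).
case: n m => [x /= /asboolP hx] [y /= /asboolP hy].
elim: hx => [{}x [b [a ->]]||u v _ hu _ hv|u _ hu].
- elim: hy => [{}y [a' [b' ->]]||u v _ hu _ hv|u _ hu].
  + have [c e] := corner b (a ** a') b'.
    by exists c; rewrite -e !numulA.
  + by rewrite numul0; exists 0.
  + by rewrite numulDr; apply: add.
  + by rewrite numulN; apply: opp.
- by rewrite nu0mul; exists 0.
- by rewrite numulDl; apply: add.
- by rewrite nuNmul; apply: opp.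
Qed.

Definition AB_pair (m : AB_bimodule) (n : BA_bimodule) : A :=
  span_val m ** span_val n.
(** A chosen preimage; as [f] is injective, its identities are checked after applying [f]. *)
Definition BA_pair (n : BA_bimodule) (m : AB_bimodule) : B :=
  sval (cid (BA_AB_image n m)).

Lemma BA_pairE n m : f (BA_pair n m) = span_val n ** span_val m.
Proof. exact: svalP (cid (BA_AB_image n m)). Qed.

Fact AB_pairDl m m' n : AB_pair (m + m') n = AB_pair m n + AB_pair m' n.
Proof. exact: numulDl. Qed.
Fact AB_pairDr m n n' : AB_pair m (n + n') = AB_pair m n + AB_pair m n'.
Proof. exact: numulDr. Qed.
Fact AB_pair_bal m b n : AB_pair (ract m b) n = AB_pair m (lact b n).
Proof. by rewrite /AB_pair /= numulA. Qed.
Fact BA_pairDl n n' m : BA_pair (n + n') m = BA_pair n m + BA_pair n' m.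
Proof. by apply: f_inj; rewrite fD !BA_pairE; exact: numulDl. Qed.
Fact BA_pairDr n m m' : BA_pair n (m + m') = BA_pair n m + BA_pair n m'.
Proof. by apply: f_inj; rewrite fD !BA_pairE; exact: numulDr. Qed.
Fact BA_pair_bal n a m : BA_pair (ract n a) m = BA_pair n (lact a m).
Proof. by apply: f_inj; rewrite !BA_pairE /= numulA. Qed.

Definition AB_prod := tens_lift AB_pair.
Definition BA_prod := tens_lift BA_pair.

Fact AB_prodE m n : AB_prod (tens m n) = AB_pair m n.
Proof. exact (tens_liftE AB_pairDl AB_pairDr AB_pair_bal m n). Qed.
Fact AB_prodD x y : AB_prod (x + y) = AB_prod x + AB_prod y.
Proof. exact (tens_liftD AB_pairDl AB_pairDr AB_pair_bal x y). Qed.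
Fact BA_prodE n m : BA_prod (tens n m) = BA_pair n m.
Proof. exact (tens_liftE BA_pairDl BA_pairDr BA_pair_bal n m). Qed.
Fact BA_prodD x y : BA_prod (x + y) = BA_prod x + BA_prod y.
Proof. exact (tens_liftD BA_pairDl BA_pairDr BA_pair_bal x y). Qed.

Fact AB_prodL a x : AB_prod (tens_lact a x) = a ** AB_prod x.
Proof.
move: x; apply: tens_additive_eq => [x y|x y|m n].
- by rewrite tens_lactD AB_prodD.
- by rewrite AB_prodD numulDr.
- by rewrite tens_lactE !AB_prodE /AB_pair /= numulA.
Qed.

Fact AB_prodR x a : AB_prod (tens_ract x a) = AB_prod x ** a.
Proof.
apply: (tens_additive_eq (f := fun x => AB_prod (tens_ract x a))
  (g := fun x => AB_prod x ** a)) => [u v|u v|m n].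
- by rewrite tens_ractD AB_prodD.
- by rewrite AB_prodD numulDl.
- by rewrite tens_ractE !AB_prodE /AB_pair /= numulA.
Qed.

Fact BA_prodL b x : BA_prod (tens_lact b x) = b ** BA_prod x.
Proof.
move: x; apply: tens_additive_eq => [x y|x y|n m].
- by rewrite tens_lactD BA_prodD.
- by rewrite BA_prodD numulDr.
- by rewrite tens_lactE !BA_prodE; apply: f_inj; rewrite fM !BA_pairE /= numulA.
Qed.

Fact BA_prodR x b : BA_prod (tens_ract x b) = BA_prod x ** b.
Proof.
apply: (tens_additive_eq (f := fun x => BA_prod (tens_ract x b))
  (g := fun x => BA_prod x ** b)) => [u v|u v|n m].
- by rewrite tens_ractD BA_prodD.
- by rewrite BA_prodD numulDl.
- by rewrite tens_ractE !BA_prodE; apply: f_inj; rewrite fM !BA_pairE /= numulA.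
Qed.

Definition AB_hom : bimodule_hom (tensor AB_bimodule BA_bimodule) (regular_bimodule A) :=
  @BimoduleHom _ _ (tensor AB_bimodule BA_bimodule) (regular_bimodule A)
    AB_prod AB_prodD AB_prodL AB_prodR.
Definition BA_hom : bimodule_hom (tensor BA_bimodule AB_bimodule) (regular_bimodule B) :=
  @BimoduleHom _ _ (tensor BA_bimodule AB_bimodule) (regular_bimodule B)
    BA_prod BA_prodD BA_prodL BA_prodR.

Lemma AB_homE m n : AB_hom (tens m n) = span_val m ** span_val n.
Proof. exact: AB_prodE. Qed.
Lemma BA_homE n m : f (BA_hom (tens n m)) = span_val n ** span_val m.
Proof. by rewrite -BA_pairE; congr f; exact: BA_prodE. Qed.

(** Idempotence of [B] replaces a unit: a product [b1 ** b2] supplies the left factor [f b1] in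
    [A]. *)
Lemma idem_in_AB b : f b \in spanp (fun x => exists a b, x = a ** f b).
Proof.
apply/asboolP; elim: (idem b) => [x [b1 [b2 ->]]||x y _ hx _ hy|x _ hx].
- by rewrite fM; apply: span_gen; exists (f b1), b2.
- by rewrite f0; apply: span0.
- by rewrite fD; apply: spanD.
- by rewrite fN; apply: spanN.
Qed.

Lemma idem_in_BA b : f b \in spanp (fun x => exists b a, x = f b ** a).
Proof.
apply/asboolP; elim: (idem b) => [x [b1 [b2 ->]]||x y _ hx _ hy|x _ hx].
- by rewrite fM; apply: span_gen; exists b1, (f b2).
- by rewrite f0; apply: span0.
- by rewrite fD; apply: spanD.
- by rewrite fN; apply: spanN.
Qed.

(** The image of an additive map is a subgroup, so surjectivity can be tested on generators. *)
Lemma bimodule_hom_image (C D : nuRingType) (M N : bimodule C D)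
    (h : bimodule_hom M N) (Q : N -> Prop) :
  (forall x, Q x -> exists t, h t = x) ->
  forall x, add_span Q x -> exists t, h t = x.
Proof.
have h0 : h 0 = 0 by apply: (addrI (h 0)); rewrite -bhomD !addr0.
move=> hQ x; elim=> [{}x /hQ//||u v _ [a <-] _ [b <-]|u _ [a <-]].
- by exists 0.
- by exists (a + b); rewrite bhomD.
- by exists (- a); apply/eqP; rewrite -addr_eq0 -bhomD addNr h0.
Qed.

(* With [C = f B], the context is [(A C, C A)] with multiplication of [A] as
   both pairings. *)
Lemma morita_of_full_corner : exists X : morita_context A B, surjective_morita X.
Proof.
have psi_phi (m : AB_bimodule) (n n' : BA_bimodule) :
    ract n' (AB_hom (tens m n)) = lact (BA_hom (tens n' m)) n.
  apply: val_inj.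
  change (span_val n' ** AB_hom (tens m n) = f (BA_hom (tens n' m)) ** span_val n).
  by rewrite AB_homE BA_homE numulA.
have phi_psi (m m' : AB_bimodule) (n : BA_bimodule) :
    ract m' (BA_hom (tens n m)) = lact (AB_hom (tens m' n)) m.
  apply: val_inj.
  change (span_val m' ** f (BA_hom (tens n m)) = AB_hom (tens m' n) ** span_val m).
  by rewrite AB_homE BA_homE numulA.
exists (MoritaContext psi_phi phi_psi); split=> /=.
- move=> a; apply: (bimodule_hom_image (h := AB_hom)) (full a).
  move=> _ [a1 [b [a2 ->]]].
  (* The middle factor is split as [f b1 ** f b2], one half for [A f B] and the other for
     [f B A]. *)
  apply: (bimodule_hom_image (h := AB_hom)
    (Q := fun x => exists b1 b2, x = a1 ** f b1 ** (f b2 ** a2))); last first.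
    elim: (idem b) => [x [b1 [b2 ->]]||x y _ hx _ hy|x _ hx].
    + by apply: span_gen; exists b1, b2; rewrite fM !numulA.
    + by rewrite f0 numul0 nu0mul; apply: span0.
    + by rewrite fD numulDr numulDl; apply: spanD.
    + by rewrite fN numulN nuNmul; apply: spanN.
  move=> _ [b1 [b2 ->]].
  have h1 : a1 ** f b1 \in spanp (fun x => exists a b, x = a ** f b).
    by apply/asboolP/span_gen; exists a1, b1.
  have h2 : f b2 ** a2 \in spanp (fun x => exists b a, x = f b ** a).
    by apply/asboolP/span_gen; exists b2, a2.
  by exists (tens (SpanType h1 : AB_bimodule) (SpanType h2 : BA_bimodule)); rewrite AB_homE.
- move=> b; apply: (bimodule_hom_image (h := BA_hom)) (idem b).
  move=> _ [b1 [b2 ->]].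
  exists (tens (SpanType (idem_in_BA b1) : BA_bimodule) (SpanType (idem_in_AB b2) : AB_bimodule)).
  by apply: f_inj; rewrite BA_homE fM.
Qed.

End FullCorner.

(** * Boundary paths and the paths of the desourcification *)

Section BoundedPaths.
Variables (k : nat) (G : kgraph k).
Implicit Types (l a : kpath G) (m n : mdeg k).

(** By factorisation, a path of positive [i]-th degree begins with an edge of degree [unitm i]. *)
Lemma noext_deg l i : pathset (rng l) (unitm i) = set0 -> deg l i = 0%N.
Proof.
move=> ne; apply/eqP; rewrite -leqn0 leqNgt; apply/negP => li.
have le_i : mle (unitm i) (deg l).
  by apply/mleP=> t; rewrite ffunE; case: eqP => [->|].
have [d1 d2 [h e]] := Defs.splitP le_i.
suff : set0 (kprefix l (unitm i)) by [].
by rewrite -ne; split=> //; rewrite rng_prefix.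
Qed.

Lemma noext_src l i :
  pathset (rng l) (unitm i) = set0 -> pathset (src l) (unitm i) = set0.
Proof.
move=> ne; rewrite -subset0 => a [ra da].
have h : src l = rng a by [].
have := @noext_deg (kcomp h) i; rewrite rng_comp => /(_ ne).
by rewrite deg_comp maddE da ffunE eqxx addn1.
Qed.

(** If [a] reaches [n i], the shortfall is in [l]; then [src l] emits no edge of colour [i], and by
    [noext_src] neither does [src a]. *)
Lemma bounded_paths_comp l a m n (h : src l = rng a) :
  bounded_paths m l -> bounded_paths n a -> bounded_paths (m + n) (kcomp h).
Proof.
move=> [lm hl] [an ha]; split; first by rewrite deg_comp; mdeg_solve.
move=> i; rewrite deg_comp src_comp !maddE => lt.
have [/ha//|an'] := ltnP (deg a i) (n i).
have lm' : (deg l i < m i)%N by move: lt an'; lia.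
by apply: noext_src; rewrite -h; apply: hl.
Qed.

Lemma bounded_paths_deg l : bounded_paths (deg l) l.
Proof. by split=> [|i]; rewrite ?mle_refl ?ltnn. Qed.

Lemma bounded_path_exists v n : exists l : kpath G, rng l = v /\ bounded_paths n l.
Proof.
(* Greedy extension: each added edge of a missing colour lowers the total defect, which [s] bounds
   strictly. *)
suff ext s l : (\sum_i (n i - deg l i) < s)%N -> mle (deg l) n ->
    exists a, rng a = rng l /\ bounded_paths n a.
  have [|a [ra ba]] := ext _ (idp v) (leqnn _).
    by rewrite deg_id mle0m.
  by exists a; rewrite ra rng_id.
elim: s l => [|s IHs] l; first by rewrite ltn0.
move=> lts ln; have [//|nb] := pselect (bounded_paths n l); first by exists l.
have [i [li ne]] : exists i, (deg l i < n i)%N /\ pathset (src l) (unitm i) !=set0.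
  apply: contrapT => H; apply: nb; split=> // i li.
  apply/eqP/negPn/negP => /set0P ne; apply: H; by exists i.
have [a [ra da]] := ne; have h : src l = rng a by [].
have [||b [rb bb]] := IHs (kcomp h).
- rewrite -ltnS; apply: leq_trans lts; rewrite ltnS (bigD1 i) //= [X in (_ < X)%N](bigD1 i) //=.
  rewrite deg_comp maddE da ffunE eqxx -addSn leq_add //; first by move: li; lia.
  by apply: leq_sum => j ji; rewrite !maddE ffunE (negbTE ji) addn0.
- apply/mleP=> j; rewrite deg_comp maddE da ffunE.
  by have /mleP/(_ j) := ln; case: eqP => [->|_] /=; move: li; lia.
by exists b; rewrite rb rng_comp.
Qed.

End BoundedPaths.

(** * Existence of boundary paths *)

Section BoundaryPathExists.
Variables (k : nat) (G : kgraph k).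
Hypothesis lc : locally_convex G.
Variable v : kvert G.

Let cst (N : nat) : mdeg k := [ffun => N].

Let step_ex (c : kpath G) : exists c', exists2 a, bounded_paths (cst 1) a
  & exists h : src c = rng a, c' = kcomp h.
Proof.
have [a [ra ba]] := bounded_path_exists (src c) (cst 1).
by exists (kcomp (esym ra)), a => //; exists (esym ra).
Qed.

Let step c := sval (cid (step_ex c)).
Let stepP c : exists2 a, bounded_paths (cst 1) a
  & exists h : src c = rng a, step c = kcomp h.
Proof. exact: svalP (cid (step_ex c)). Qed.
Let chain N := iter N step (idp v).

Let chain_bounded N : bounded_paths (cst N) (chain N).
Proof.
elim: N => [|N IHN] /=.
  by split=> [|i]; rewrite deg_id ?mle0m // !ffunE.
have [a ba [h ->]] := stepP (chain N).
have -> : cst N.+1 = cst N + cst 1 by apply/ffunP=> i; rewrite maddE !ffunE addn1.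
exact: bounded_paths_comp.
Qed.

Let chain_split N d : exists a, exists h : src (chain N) = rng a,
  chain (N + d) = kcomp h.
Proof.
elim: d => [|d [a [h e]]].
  have h : src (chain N) = rng (idp (src (chain N))) by rewrite rng_id.
  by exists (idp (src (chain N))), h; rewrite comp_idr addn0.
have [b _ [hb eb]] := stepP (chain (N + d)).
have h1 : src a = rng b by rewrite -hb e src_comp.
have h2 : src (chain N) = rng (kcomp h1) by rewrite rng_comp.
exists (kcomp h1), h2; rewrite addnS [LHS]eb.
have h3 : src (kcomp h) = rng b by rewrite -e.
by rewrite (kcompA h2 h3); apply: comp_irr.
Qed.

Let chain_le N M i : (N <= M)%N -> (deg (chain N) i <= deg (chain M) i)%N.
Proof.
move=> /subnKC <-; have [a [h ->]] := chain_split N (M - N).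
by rewrite deg_comp maddE leq_addr.
Qed.

(** A coordinate of [chain N] below [N] means that its source emits no edge of colour [i], so this
    coordinate never grows again. *)
Let chain_stable N M i : (N <= M)%N -> (deg (chain N) i < N)%N ->
  deg (chain M) i = deg (chain N) i.
Proof.
move=> /subnKC <- lt; have [a [h ->]] := chain_split N (M - N).
rewrite deg_comp maddE (@noext_deg _ _ a i) ?addn0 //.
by rewrite -h; apply: (chain_bounded N).2; rewrite ffunE.
Qed.

Let chain_prefix N M p : (N <= M)%N -> mle p (deg (chain N)) ->
  kprefix (chain M) p = kprefix (chain N) p.
Proof.
move=> /subnKC <- pN; have [a [h ->]] := chain_split N (M - N).
exact: prefix_comp.
Qed.

(** The limit degree: coordinate [i] is finite exactly when the chain stalls in direction [i]. *)
Let e : edeg k := [ffun i =>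
  match pselect (exists N, (deg (chain N) i < N)%N) with
  | left H => Some (deg (chain (sval (cid H))) i) | right _ => None end].

Let e_some i a : e i = Some a -> exists N, deg (chain N) i = a /\ (a < N)%N.
Proof.
rewrite ffunE; case: pselect => // H [<-].
by exists (sval (cid H)); split=> //; apply: svalP (cid H).
Qed.

Let e_le N : mlee (deg (chain N)) e.
Proof.
apply/mleeP=> i; case E: (e i) => [a|//].
have [M [<- lt]] := e_some E.
rewrite -(chain_stable (leq_maxr N M)) //; exact/chain_le/leq_maxl.
Qed.

Let e_cover q : mlee q e -> exists N, mle q (deg (chain N)).
Proof.
move=> /mleeP qe.
have H i : exists N, (q i <= deg (chain N) i)%N.
  have := qe i; case E: (e i) => [a|].
    by have [N [dN _]] := e_some E; exists N; rewrite dN.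
  move=> _; exists (q i); rewrite leqNgt; apply/negP => lt.
  by move: E; rewrite ffunE; case: pselect => // -[]; exists (q i).
pose f i := sval (cid (H i)).
exists (\sum_i f i)%N; apply/mleP=> i.
apply: leq_trans (svalP (cid (H i))) _; apply: chain_le.
by rewrite -/(f i) (bigD1 i) //= leq_addr.
Qed.

(** The implication stays under the existential to make [W] total; for [q] not below [e] the index
    is arbitrary. *)
Let cover_ex q : exists N, mlee q e -> mle q (deg (chain N)).
Proof.
have [/e_cover[N hN]|nq] := pselect (mlee q e); first by exists N.
by exists 0%N.
Qed.
Let ind q := sval (cid (cover_ex q)).
Let indP q := svalP (cid (cover_ex q)).
Let W q := kprefix (chain (ind q)) q.

Let WE q N : mle q (deg (chain N)) -> W q = kprefix (chain N) q.
Proof.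
move=> qN; have qi := indP (mlee_trans qN (e_le N)).
rewrite /W -(chain_prefix (leq_maxl (ind q) N)) //.
by rewrite -(chain_prefix (leq_maxr (ind q) N)).
Qed.

Let degW q : mlee q e -> deg (W q) = q.
Proof. by move=> /indP/Defs.splitP[]. Qed.

Let prefixW p q : mle p q -> mlee q e -> kprefix (W q) p = W p.
Proof.
move=> pq /indP qN; rewrite (WE qN) Defs.prefix_prefix //.
by rewrite (@WE p (ind q)) //; apply: mle_trans qN.
Qed.

(** Some [chain K] extends [W p], has [i]-th degree [p i] and ends without an edge of colour [i].
    The remaining suffix has [i]-th degree 0, so local convexity would carry an edge at the end of
    [W p] to the end of [chain K]. *)
Let W_bound (p : kvert (Omega e)) i : e i = Some (val p i) ->
  pathset (kfvert (functor_of_segs degW prefixW) p) (unitm i) = set0.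
Proof.
case: p => p /= pe /e_some[N [dN ltN]].
have [M pM] := e_cover pe; pose K := maxn N M.
have pK : mle p (deg (chain K)).
  by apply: mle_trans pM _; apply/mleP => j; apply/chain_le/leq_maxr.
have dK : deg (chain K) i = p i by rewrite (@chain_stable N) ?leq_maxl ?dN.
rewrite (WE pK); have [d1 d2 [h E]] := Defs.splitP pK.
apply/eqP/negPn/negP => /set0P; rewrite h => ne.
have := locally_convex_transport lc _ ne; rewrite d2 ffunE dK subnn => /(_ erefl).
rewrite -(src_comp h) E => /set0P/eqP; apply.
apply: (chain_bounded K).2; rewrite ffunE dK.
by apply: leq_trans ltN _; apply: leq_maxl.
Qed.

(* The union of an increasing chain of paths, the [N]-th one lying in
   [v Lambda^{<= (N,...,N)}]. *)
Lemma boundary_path_exists : exists x : bpath G, brng x = v.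
Proof.
exists (BPath W_bound); rewrite /brng /=.
rewrite deg0_src ?degW ?mlee0 //.
by rewrite (@WE 0 0) ?mle0m // rng_prefix ?mle0m // rng_id.
Qed.

End BoundaryPathExists.

(** * Triples classifying the paths of the desourcification *)

Section Triples.
Variables (k : nat) (G : kgraph k).
Hypothesis lc : locally_convex G.
Implicit Types (l a : kpath G) (m n t : mdeg k) (x y : bpath G).

(* [(u, t)] is [vinv] of a vertex of the desourcification. *)
Definition dead_end (u : kvert G) t :=
  forall i, (0 < t i)%N -> pathset u (unitm i) = set0.

Lemma bdeg_noext y i : pathset (brng y) (unitm i) = set0 -> bdeg y i = Some 0%N.
Proof.
move=> ne; apply: contrapT => nz.
have le1 : mlee (unitm i) (bdeg y).
  apply/mleeP=> j; rewrite ffunE; case: eqP => [->|_]; last by case: (bdeg y j).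
  by case: (bdeg y i) nz => [[|a]|].
suff : set0 (bseg y (mle0m (unitm i))) by [].
rewrite -ne; split; first by rewrite rng_bseg bvtx0.
by rewrite deg_bseg (mcapK le1); mdeg_solve.
Qed.

(** A positive overhang means that the boundary path has already reached its full degree in that
    coordinate. *)
Lemma dvert_dead_end (w : dvert G) : dead_end (vinv w).1 (vinv w).2.
Proof.
move=> i; rewrite ffunE subn_gt0 => lt; apply: bvtx_bound.
by move: lt; rewrite !ffunE; case: (bdeg _ i) => [a|]; rewrite ?ltnn // => lt; congr Some; lia.
Qed.

Lemma dpath_bounded (b : dpath G) : bounded_paths (pinv b).2 (pinv b).1.1.
Proof.
split; first exact: plam_le.
move=> i; rewrite /= deg_bseg src_bseg => lt; apply: bvtx_bound.
have /mleP/(_ i) := pp_le (prep b).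
by move: lt; rewrite !ffunE; case: (bdeg _ i) => [a|]; rewrite ?ltnn // => lt; move=> ?; congr Some; lia.
Qed.

(** With [y] a boundary path from [src l] and [z] the concatenation of [l] and [y], the class of
    [(z; (t, t + n))] works: the hypotheses force [t] and [t + n], cut down to the degree of [z], to
    be [0] and [deg l]. *)
Lemma dpath_of_triple l t n : bounded_paths n l -> dead_end (rng l) t ->
  exists b : dpath G, pinv b = (l, t, n).
Proof.
move=> [ln hl] ht; have [y yl] := boundary_path_exists lc (src l).
pose z := bconcat lc (esym yl); exists (pclass z (mle_addr t n)).
have dl i : (0 < t i)%N -> deg l i = 0%N by move=> /ht/noext_deg.
have dz i : bdeg z i = omap (addn (deg l i)) (bdeg y i) by rewrite /= ffunE.
have dy i : (0 < t i)%N || (deg l i < n i)%N -> bdeg y i = Some 0%N.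
  move=> lt; apply: bdeg_noext; rewrite yl.
  by case/orP: lt => [/ht/noext_src|/hl].
have c0 : mcap t (bdeg z) = 0.
  apply/ffunP=> i; rewrite m0E [LHS]ffunE dz.
  have [t0|t0] := posnP (t i); first by rewrite t0; case: (bdeg y i) => //= a; rewrite min0n.
  by rewrite dy ?t0 //= addn0 dl // minn0.
have cn : mcap (t + n) (bdeg z) = deg l.
  apply/ffunP=> i; rewrite ffunE dz maddE; have /mleP/(_ i) := ln.
  have [lt|] := boolP ((0 < t i)%N || (deg l i < n i)%N).
    by rewrite dy //=; lia.
  by rewrite negb_or -!leqNgt leqn0 => /andP[/eqP-> ?] ?; case: (bdeg y i) => [a|] /=; lia.
rewrite pinvE maddK /overhang c0; congr (_, _, _).
- have h0 : mle 0 (deg l) by apply: mle0m.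
  rewrite -[RHS](bseg_concat_initial lc (esym yl) h0) -/z.
  apply: bseg_eq; first by rewrite c0; mdeg_solve.
  rewrite cn mcapK //=; mdeg_solve.
- by apply/ffunP=> i; rewrite !ffunE subn0.
Qed.

End Triples.

(** * Local units *)

Section KPElements.
Variables (R : comPzRingType) (k : nat) (G : kgraph k).
Implicit Types (x y : KP R G) (v : kvert G) (l : kpath G).

Lemma KP_ind (Q : KP R G -> Prop) :
  (forall v, Q (kpP R v)) -> (forall l, Q (kpS R l)) -> (forall l, Q (kpT R l)) ->
  Q 0 -> (forall x y, Q x -> Q y -> Q (x + y)) -> (forall x, Q x -> Q (- x)) ->
  (forall r x, Q x -> Q (r *: x)) -> (forall x y, Q x -> Q y -> Q (x ** y)) ->
  forall x, Q x.
Proof.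
move=> QP QS QT Q0 QD QN QZ QM x; rewrite -(kp_reprK x).
elim: (kp_repr x) => // [a IHa b IHb|a IHa|r a IHa|a IHa b IHb].
- by rewrite -kp_addE; apply: QD.
- by rewrite -kp_oppE; apply: QN.
- by rewrite -kp_scaleE; apply: QZ.
- by rewrite -kp_mulE; apply: QM.
Qed.

Let fam := KP_family_KP R G.

Lemma kpP_sum_unit (s : seq (kvert G)) v : uniq s -> v \in s ->
  (\sum_(w <- s) kpP R w) ** kpP R v = kpP R v /\
  kpP R v ** (\sum_(w <- s) kpP R w) = kpP R v.
Proof.
move=> us vs; rewrite numul_suml numul_sumr.
rewrite (bigD1_seq v) //= big1 ?addr0; last first.
  by move=> w /negbTE wv; rewrite (kp1 fam) wv.
rewrite (bigD1_seq v) //= big1 ?addr0; last first.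
  by move=> w /negbTE wv; rewrite (kp1 fam) eq_sym wv.
by rewrite (kp1 fam) eqxx.
Qed.

Lemma KP_local_unit x : exists s : seq (kvert G),
  (\sum_(v <- s) kpP R v) ** x = x /\ x ** (\sum_(v <- s) kpP R v) = x.
Proof.
(* Asking for every larger duplicate-free list makes the units of two elements compatible. *)
suff [s hs] : exists s : seq (kvert G), forall s', uniq s' -> {subset s <= s'} ->
    (\sum_(v <- s') kpP R v) ** x = x /\ x ** (\sum_(v <- s') kpP R v) = x.
  exists (undup s); apply: hs (undup_uniq s) _ => v.
  by rewrite mem_undup.
elim/(@KP_ind): x => [v|l|l||x y [s hs] [t ht]|x [s hs]|r x [s hs]|x y [s hs] [t ht]].
- by exists [:: v] => s us /(_ v (mem_head _ _)) vs; apply: kpP_sum_unit.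
- exists [:: rng l; src l] => s us sub.
  have rs : rng l \in s by apply: sub; rewrite inE eqxx.
  have ss : src l \in s by apply: sub; rewrite !inE eqxx orbT.
  split; first by rewrite -(kp2rS fam) numulA (kpP_sum_unit us rs).1.
  by rewrite -(kp2Ss fam) -numulA (kpP_sum_unit us ss).2.
- exists [:: rng l; src l] => s us sub.
  have rs : rng l \in s by apply: sub; rewrite inE eqxx.
  have ss : src l \in s by apply: sub; rewrite !inE eqxx orbT.
  split; first by rewrite -(kp2sT fam) numulA (kpP_sum_unit us ss).1.
  by rewrite -(kp2Tr fam) -numulA (kpP_sum_unit us rs).2.
- by exists [::] => s _ _; rewrite numul0 nu0mul.
- exists (s ++ t) => s' us sub.
  have [|e1 e2] := ht s' us; first by move=> v vs; rewrite sub // mem_cat vs orbT.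
  have [|f1 f2] := hs s' us; first by move=> v vs; rewrite sub // mem_cat vs.
  by rewrite numulDr numulDl e1 e2 f1 f2.
- exists s => s' us sub; have [e1 e2] := hs s' us sub.
  by rewrite numulN nuNmul e1 e2.
- exists s => s' us sub; have [e1 e2] := hs s' us sub.
  by rewrite -nuscaleAr -nuscaleAl e1 e2.
- exists (s ++ t) => s' us sub.
  have [|f1 _] := hs s' us; first by move=> v vs; rewrite sub // mem_cat vs.
  have [|_ e2] := ht s' us; first by move=> v vs; rewrite sub // mem_cat vs orbT.
  by rewrite -numulA e2 numulA f1.
Qed.

(** A local unit on each side of [x - y] reduces equality to these products, which are the ones
    visible in the action on columns used for injectivity. *)
Lemma KP_eq_of_products x y :
  (forall v z, kpP R v ** (x ** z) = kpP R v ** (y ** z)) -> x = y.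
Proof.
move=> h; apply/eqP; rewrite -subr_eq0; apply/eqP.
have [s [e1 e2]] := KP_local_unit (x - y).
rewrite -e1 -{1}e2 numul_suml big1 // => v _.
by rewrite numulDl nuNmul numulDr numulN h subrr.
Qed.

Lemma KP_idempotent x : add_span (fun z => exists x1 x2, z = x1 ** x2) x.
Proof.
have [s [e1 _]] := KP_local_unit x.
by rewrite -e1; apply: span_gen; exists (\sum_(v <- s) kpP R v), x.
Qed.

(** For nonzero degree this is [kp3]; degree 0, which [kp3] excludes, comes from [kp1]. *)
Lemma kpTS l m : deg l = deg m ->
  kpT R l ** kpS R m = if l == m then kpP R (src l) else 0.
Proof.
move=> d; have [l0|l0] := eqVneq (deg l) 0; last first.
  have bl := bounded_paths_deg l.
  by rewrite (kp3 fam l0) // d; apply: bounded_paths_deg.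
have m0 : deg m = 0 by rewrite -d.
rewrite (deg0_id l0) (deg0_id m0) (kp_T_id fam) (kp_S_id fam) (kp1 fam) src_id.
case: eqP => [->|ne]; first by rewrite eqxx.
by case: eqP => // /(congr1 (@rng _ G)); rewrite !rng_id.
Qed.

End KPElements.

(** * The embedding in the desourcification *)

Section TripleModel.
Variables (k : nat) (G : kgraph k).
Hypothesis lc : locally_convex G.
Local Notation D := (desourcification lc).
Local Notation vtx w := (@vinv k G w).1.
Local Notation vov w := (@vinv k G w).2.
Local Notation lam b := (@pinv k G b).1.1.
Local Notation pov b := (@pinv k G b).1.2.
Implicit Types (u v : kvert G) (l : kpath G) (m n t : mdeg k).
Implicit Types (w : kvert D) (b c : kpath D).

Lemma vinv_rng b : vinv (rng b) = (rng (lam b), pov b).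
Proof. exact: vinv_drng. Qed.

Lemma vinv_src b : vinv (src b) = (src (lam b), msub (pov b + deg b) (deg (lam b))).
Proof. exact: vinv_dsrc. Qed.

Lemma pinv_deg b : (pinv b).2 = deg b. Proof. by []. Qed.

Lemma pinv_eta b : pinv b = (lam b, pov b, deg b).
Proof. by rewrite -pinv_deg; case: (pinv b) => [[]]. Qed.

Lemma pinv_idp w : pinv (idp w) = (idp (vtx w), vov w, 0).
Proof. exact: didp_inv. Qed.

Lemma pinv_comp b c l l' (h : src b = rng c) : lam b = l -> lam c = l' ->
  exists h' : src l = rng l', pinv (kcomp h) = (kcomp h', pov b, deg b + deg c).
Proof.
move=> <- <-; have h' := dcomp_composable h.
by exists h'; apply: pinv_dcomp.
Qed.

(** The desourcification has no sources: the class of [(x; (m, m + unitm i))] starts at the vertex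
    of [(x; m)]. *)
Lemma bounded_paths_desourcification n b : bounded_paths n b <-> deg b = n.
Proof.
split=> [[le_n ne]|<-]; last exact: bounded_paths_deg.
apply/ffunP=> i; apply/eqP; rewrite eqn_leq; have /mleP-> := le_n.
rewrite leqNgt; apply/negP => /ne.
have [x [m e]] : exists x m, src b = vclass x m :> dvert G.
  by exists (vrep_path (src b)), (vrep_deg (src b)); rewrite vclassK.
suff: pathset (src b) (unitm i) (pclass x (mle_addr m (unitm i)) : kpath D) by move=> + e0; rewrite e0.
split; first by rewrite e; apply: drngE.
by rewrite [LHS]ddegE maddK.
Qed.

Lemma bounded_idp u n : dead_end u n -> bounded_paths n (idp u).
Proof.
move=> ne; split=> [|i]; rewrite deg_id ?mle0m //.
by rewrite m0E src_id; apply: ne.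
Qed.

Lemma dead_end0 u : dead_end u 0. Proof. by move=> i; rewrite m0E. Qed.

Lemma dead_end_bounded l n : bounded_paths n l -> dead_end (src l) (msub n (deg l)).
Proof. by move=> [_ ne] i; rewrite ffunE subn_gt0; apply: ne. Qed.

(** Stated as an implication so that [triple_path] is total; for inadmissible triples the value is
    arbitrary. *)
Fact triple_path_subproof l t n : exists b : kpath D,
  bounded_paths n l -> dead_end (rng l) t -> pinv b = (l, t, n).
Proof.
have [[bl de]|no] := pselect (bounded_paths n l /\ dead_end (rng l) t).
  by have [b e] := dpath_of_triple lc bl de; exists b.
have [b _] := dpath_of_triple lc (bounded_paths_deg l) (@dead_end0 (rng l)).
by exists b => bl de; case: no.
Qed.
Definition triple_path l t n : kpath D := sval (cid (triple_path_subproof l t n)).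
Lemma triple_pathE l t n : bounded_paths n l -> dead_end (rng l) t ->
  pinv (triple_path l t n) = (l, t, n).
Proof. exact: svalP (cid (triple_path_subproof l t n)). Qed.

(* [iota_path] embeds [Lambda] into its desourcification, and every vertex is
   the source of [tail w], the only path of its degree leaving [iota_vert]. *)
Definition iota_path l : kpath D := triple_path l 0 (deg l).
Definition iota_vert v : kvert D := rng (iota_path (idp v)).
Definition tail w : kpath D := triple_path (idp (vtx w)) 0 (vov w).

Lemma pinv_iota l : pinv (iota_path l) = (l, 0, deg l).
Proof. by apply: triple_pathE; [apply: bounded_paths_deg|apply: dead_end0]. Qed.

Lemma lam_iota l : lam (iota_path l) = l. Proof. by rewrite pinv_iota. Qed.

Lemma deg_iota l : deg (iota_path l) = deg l.
Proof. by rewrite -pinv_deg pinv_iota. Qed.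

Lemma vinv_iota v : vinv (iota_vert v) = (v, 0).
Proof. by rewrite vinv_rng pinv_iota rng_id. Qed.

Lemma iota_vert_inj : injective iota_vert.
Proof. by move=> u v /(congr1 (fun w : kvert D => vtx w)); rewrite !vinv_iota. Qed.

Lemma rng_iota l : rng (iota_path l) = iota_vert (rng l).
Proof. by apply: vinv_inj; rewrite vinv_iota vinv_rng pinv_iota. Qed.

Lemma src_iota l : src (iota_path l) = iota_vert (src l).
Proof.
apply: vinv_inj; rewrite vinv_iota vinv_src deg_iota pinv_iota /=.
by congr pair; mdeg_solve.
Qed.

Lemma iota_idp v : iota_path (idp v) = idp (iota_vert v).
Proof. by apply: pinv_inj; rewrite pinv_iota pinv_idp vinv_iota deg_id. Qed.

Lemma iota_comp l l' (h : src l = rng l')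
    (h' : src (iota_path l) = rng (iota_path l')) :
  kcomp h' = iota_path (kcomp h).
Proof.
apply: pinv_inj; have [h2 ->] := pinv_comp h' (lam_iota l) (lam_iota l').
rewrite !deg_iota !pinv_iota deg_comp; congr (_, _, _).
exact: comp_irr.
Qed.

(** The missing degree [msub n (deg l)] is supplied by a path [c] lying over the vertex [src l],
    which is a dead end in exactly the short directions. *)
Lemma iota_split l n (bl : bounded_paths n l) :
  exists b c (h : src (iota_path l) = rng c),
  [/\ pinv b = (l, 0, n), rng c = iota_vert (src l), lam c = idp (src l) & b = kcomp h].
Proof.
pose c := triple_path (idp (src l)) 0 (msub n (deg l)).
have cE : pinv c = (idp (src l), 0, msub n (deg l)).
  by apply: triple_pathE (@dead_end0 _); apply/bounded_idp/dead_end_bounded.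
have rc : rng c = iota_vert (src l).
  by apply: vinv_inj; rewrite vinv_rng vinv_iota cE rng_id.
have h : src (iota_path l) = rng c by rewrite rc src_iota.
exists (triple_path l 0 n), c, h; split=> //; rewrite ?cE //.
  exact: triple_pathE (@dead_end0 _).
apply: pinv_inj; rewrite triple_pathE //; last exact: dead_end0.
have lc' : lam c = idp (src l) by rewrite cE.
have [h2 ->] := pinv_comp h (lam_iota l) lc'; rewrite comp_idr.
rewrite deg_iota -pinv_deg pinv_iota cE.
by congr (_, _, _); rewrite msubK //; case: bl.
Qed.

Lemma pinv_tail w : pinv (tail w) = (idp (vtx w), 0, vov w).
Proof.
apply: triple_pathE (@dead_end0 _).
exact/bounded_idp/dvert_dead_end.
Qed.

Lemma rng_tail w : rng (tail w) = iota_vert (vtx w).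
Proof. by apply: vinv_inj; rewrite vinv_iota vinv_rng pinv_tail rng_id. Qed.

Lemma src_tail w : src (tail w) = w.
Proof.
apply: vinv_inj; rewrite vinv_src -pinv_deg pinv_tail /= src_id deg_id.
by rewrite [RHS]surjective_pairing; congr pair; mdeg_solve.
Qed.

Lemma tail_iota v : tail (iota_vert v) = idp (iota_vert v).
Proof. by apply: pinv_inj; rewrite pinv_tail pinv_idp vinv_iota. Qed.

(* Moving [b] past the tails turns it into a path of [Lambda]. *)
Lemma tail_comp b (h : src (tail (rng b)) = rng b)
    (h' : src (iota_path (lam b)) = rng (tail (src b))) : kcomp h = kcomp h'.
Proof.
have e1 : lam (tail (rng b)) = idp (rng (lam b)) by rewrite pinv_tail vinv_rng.
have e2 : lam (tail (src b)) = idp (src (lam b)) by rewrite pinv_tail vinv_src.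
apply: pinv_inj; have [h1 ->] := pinv_comp h e1 erefl.
have [h2 ->] := pinv_comp h' (lam_iota _) e2.
rewrite comp_idl comp_idr deg_iota -!pinv_deg !pinv_tail pinv_iota.
rewrite vinv_rng vinv_src pinv_deg; congr (_, _, _).
by have := plam_le b; rewrite pinv_deg => le_b; mdeg_solve.
Qed.

(** The range fixes the overhang, so all three components of [pinv] agree. *)
Lemma lam_inj b c : rng b = rng c -> deg b = deg c -> lam b = lam c -> b = c.
Proof.
move=> er ed el; have eo : pov b = pov c.
  by have := congr1 (fun w : kvert D => vov w) er; rewrite !vinv_rng.
by apply: pinv_inj; rewrite (pinv_eta b) (pinv_eta c) eo ed el.
Qed.

(** Boundedness of [lam b] makes [v] a dead end in every direction where [deg b] is positive, so
    [lam c] has degree 0 as well. *)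
Lemma deg0_lam_unique b c v : lam b = idp v -> rng c = rng b -> deg c = deg b -> c = b.
Proof.
move=> lb rc dc; have rl : rng (lam c) = v.
  by move: rc => /(congr1 (@vinv k G)); rewrite !vinv_rng lb rng_id => -[].
apply: lam_inj => //; rewrite lb -rl; apply: deg0_id; apply/ffunP=> i.
have [_ /(_ i)] := dpath_bounded b.
have [/mleP/(_ i)] := dpath_bounded c.
rewrite lb deg_id src_id -rl !m0E !pinv_deg dc => le_c _ ne.
have [n0|/ne/noext_deg//] := posnP (deg b i).
by apply/eqP; rewrite -leqn0 -n0.
Qed.

(** [lam] is a bijection from the paths of degree [n] at [w] onto the bounded paths at [vtx w],
    which matches the sums in [kp4] for the two graphs. *)
Lemma desourcification_enum w n (s : seq (kpath D)) :
  uniq s -> (forall b, b \in s <-> rng b = w /\ bounded_paths n b) ->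
  uniq [seq lam b | b : kpath D <- s] /\
  forall l, l \in [seq lam b | b : kpath D <- s] <-> rng l = vtx w /\ bounded_paths n l.
Proof.
move=> us hs; split.
  rewrite map_inj_in_uniq // => b c /hs[rb /bounded_paths_desourcification db].
  move=> /hs[rc /bounded_paths_desourcification dc] e.
  by apply: lam_inj => //; rewrite ?rb ?db.
move=> l; split=> [/mapP[b /hs[<- /bounded_paths_desourcification <-] ->]|[rl bl]].
  by rewrite vinv_rng; split=> //; apply: dpath_bounded.
have de : dead_end (rng l) (vov w) by rewrite rl; apply: dvert_dead_end.
have e := triple_pathE bl de.
apply/mapP; exists (triple_path l (vov w) n); last by rewrite e.
apply/hs; split; last by apply/bounded_paths_desourcification; rewrite -pinv_deg e.
by apply: vinv_inj; rewrite vinv_rng e rl -surjective_pairing.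
Qed.

End TripleModel.

(** * The Kumjian-Pask family of embedded paths *)

Section Corner.
Variables (R : comPzRingType) (k : nat) (G : kgraph k).
Hypothesis lc : locally_convex G.
Local Notation D := (desourcification lc).
Local Notation vtx w := (@vinv k G w).1.
Local Notation vov w := (@vinv k G w).2.
Local Notation lam b := (@pinv k G b).1.1.
Local Notation A := (KP R D).
Local Notation B := (KP R G).
Local Notation P := (@kpP R k D).
Local Notation S := (@kpS R k D).
Local Notation T := (@kpT R k D).
Implicit Types (u v : kvert G) (l : kpath G) (m n : mdeg k).
Implicit Types (w : kvert D) (b c : kpath D).

Let famA := KP_family_KP R D.

Lemma kpTS_self b : T b ** S b = P (src b).
Proof. by rewrite kpTS // eqxx. Qed.

(** By [deg0_lam_unique] the sum in [kp4] has the single term [b]. *)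
Lemma kpST_self b v : lam b = idp v -> S b ** T b = P (rng b).
Proof.
move=> lb; have [b0|b0] := eqVneq (deg b) 0.
  rewrite {1 2}(deg0_id b0) (kp_S_id famA) (kp_T_id famA) (kp1 famA).
  by rewrite eqxx.
rewrite (kp4 famA (v := rng b) (s := [:: b]) b0) ?big_seq1 // => c.
rewrite inE; split=> [/eqP->|[rc /bounded_paths_desourcification dc]].
  by split=> //; apply: bounded_paths_deg.
by apply/eqP; apply: deg0_lam_unique lb rc dc.
Qed.

(* A path of [Lambda^{<= n}] prolonged by tails to degree exactly [n]. *)
Lemma kp_iota_split l n : bounded_paths n l -> exists b c,
  [/\ pinv b = (l, 0, n), src b = src c, S c ** T c = P (iota_vert lc (src l)),
      S (iota_path lc l) = S b ** T c & T (iota_path lc l) = S c ** T b].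
Proof.
move=> bl; have [b [c [h [eb rc ec e]]]] := iota_split lc bl.
exists b, c; have STc := kpST_self ec; split=> //.
- by rewrite e src_comp.
- by rewrite STc rc.
- by rewrite e -(kp2S famA) -numulA STc -h (kp2Ss famA).
- by rewrite e -(kp2T famA) numulA STc -h (kp2sT famA).
Qed.

Lemma iota_family : KP_family (fun v => P (iota_vert lc v))
  (fun l => S (iota_path lc l)) (fun l => T (iota_path lc l)).
Proof.
split.
- by move=> v; rewrite iota_idp (kp_S_id famA).
- by move=> v; rewrite iota_idp (kp_T_id famA).
- by move=> u v; rewrite (kp1 famA) (inj_eq (@iota_vert_inj _ _ lc)).
- move=> l m h; have h' : src (iota_path lc l) = rng (iota_path lc m).
    by rewrite src_iota rng_iota h.
  by rewrite (kp2S famA h') iota_comp.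
- move=> l m h; have h' : src (iota_path lc l) = rng (iota_path lc m).
    by rewrite src_iota rng_iota h.
  by rewrite (kp2T famA h') iota_comp.
- by move=> l; rewrite -rng_iota (kp2rS famA).
- by move=> l; rewrite -src_iota (kp2Ss famA).
- by move=> l; rewrite -src_iota (kp2sT famA).
- by move=> l; rewrite -rng_iota (kp2Tr famA).
(* [l] and [m] may differ in degree; their prolongations [b] and [b'] both have degree [n], so
   [kpTS] applies to them. *)
- move=> n l m n0 bl bm.
  have [b [c [eb sb STc Sl Tl]]] := kp_iota_split bl.
  case: eqVneq => [<-|ne].
    by rewrite Tl Sl !numulA -(numulA (S c)) kpTS_self sb (kp2Ss famA).
  have [b' [c' [eb' _ _ Sm _]]] := kp_iota_split bm.
  rewrite Tl Sm !numulA -(numulA (S c)) kpTS; last by rewrite -!pinv_deg eb eb'.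
  case: eqP => [e|_]; last by rewrite numul0 nu0mul.
  by case/eqP: ne; move: eb; rewrite e eb' => -[->].
- move=> v n s n0 us hs.
  (* [f] enumerates the paths of degree [n] at [iota_vert lc v]; the added tails cancel in each term
     [S b ** T b]. *)
  pose f l := triple_path lc l 0 n.
  have fE l : l \in s -> pinv (f l) = (l, 0, n).
    by move=> /hs[_ bl]; apply: triple_pathE bl (@dead_end0 _ _ _).
  rewrite (kp4 famA (v := iota_vert lc v) (s := map f s) n0).
  + rewrite big_map; apply: eq_big_seq => l ls.
    have [_ bl] := (hs l).1 ls.
    have [b [c [eb sb _ -> ->]]] := kp_iota_split bl.
    have -> : f l = b by apply: pinv_inj; rewrite eb fE.
    by rewrite !numulA -(numulA (S b)) kpTS_self -sb (kp2Ss famA).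
  + rewrite map_inj_in_uniq // => l m ls ms e.
    by have := fE _ ls; rewrite e fE // => -[].
  + move=> b; split=> [/mapP[l ls ->]|[rb /bounded_paths_desourcification db]].
      split; last by apply/bounded_paths_desourcification; rewrite -pinv_deg fE.
      apply: vinv_inj; rewrite vinv_rng fE // vinv_iota.
      by have [-> _] := (hs l).1 ls.
    have bl : lam b \in s.
      apply/hs; split; last by rewrite -db; apply: dpath_bounded.
      by move: rb => /(congr1 (fun w : kvert D => vtx w)); rewrite vinv_rng vinv_iota.
    apply/mapP; exists (lam b) => //.
    apply: pinv_inj; rewrite fE // (pinv_eta b) db; congr (_, _, _).
    by move: rb => /(congr1 (fun w : kvert D => vov w)); rewrite vinv_rng vinv_iota.
Qed.

(** * The image of the induced homomorphism is a full corner *)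

Section IotaHom.
Variable f : B -> A.
Hypothesis flin : linear f.
Hypothesis fM : {morph f : x y / x ** y}.
Hypothesis fP : forall v, f (kpP R v) = P (iota_vert lc v).
Hypothesis fS : forall l, f (kpS R l) = S (iota_path lc l).
Hypothesis fT : forall l, f (kpT R l) = T (iota_path lc l).

Fact iota_homD : {morph f : x y / x + y}.
Proof. by move=> x y; have := flin 1 x y; rewrite !scale1r. Qed.
Fact iota_hom0 : f 0 = 0.
Proof. by apply: (addrI (f 0)); rewrite -iota_homD !addr0. Qed.
Fact iota_homZ r x : f (r *: x) = r *: f x.
Proof. by have := flin r x 0; rewrite iota_hom0 !addr0. Qed.
Fact iota_homN x : f (- x) = - f x.
Proof. by rewrite -!scaleN1r iota_homZ. Qed.

Lemma iota_image_sum (I : Type) (s : seq I) (F : I -> A) :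
  (forall i, exists y, F i = f y) -> exists y, \sum_(i <- s) F i = f y.
Proof.
move=> h; elim/big_rec: _ => [|i _ _ [y ->]]; first by exists 0; rewrite iota_hom0.
by have [x ->] := h i; exists (x + y); rewrite iota_homD.
Qed.

(** The matrix with the single entry [x] in position [(w, w')], the tails serving as matrix
    units. *)
Definition tail_form (a : A) : Prop :=
  exists w x w', a = T (tail w) ** f x ** S (tail w').

Lemma T_tail_S_tail w : T (tail w) ** S (tail w) = P w.
Proof. by rewrite kpTS_self src_tail. Qed.

Lemma T_tail_iota w : T (tail w) ** P (iota_vert lc (vtx w)) = T (tail w).
Proof. by rewrite -rng_tail (kp2Tr famA). Qed.

Lemma S_tail_T_tail w w' : S (tail w) ** T (tail w') =
  if w == w' then P (iota_vert lc (vtx w)) else 0.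
Proof.
case: eqVneq => [<-|ne].
  by rewrite (@kpST_self _ (vtx w)) ?rng_tail // pinv_tail.
rewrite -(kp2Ss famA) -(kp2sT famA) !src_tail numulA -(numulA _ (P w)).
by rewrite (kp1 famA) (negbTE ne) numul0 nu0mul.
Qed.

Lemma tail_formP w : tail_form (P w).
Proof.
exists w, (kpP R (vtx w)), w.
by rewrite fP T_tail_iota T_tail_S_tail.
Qed.

Fact tail_comp_exists b : exists (h : src (tail (rng b)) = rng b)
  (h' : src (iota_path lc (lam b)) = rng (tail (src b))), kcomp h = kcomp h'.
Proof.
have h : src (tail (rng b)) = rng b by rewrite src_tail.
have h' : src (iota_path lc (lam b)) = rng (tail (src b)).
  by rewrite src_iota rng_tail vinv_src.
by exists h, h'; apply: tail_comp.
Qed.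

(** Inserting [P (rng b)] as [T (tail _) ** S (tail _)] and moving the tail past [b] by [tail_comp]
    leaves [lam b] in the middle. *)
Lemma tail_formS b : tail_form (S b).
Proof.
exists (rng b), (kpS R (lam b)), (src b).
have [h [h' e]] := tail_comp_exists b.
rewrite fS -numulA (kp2S famA h') -e -(kp2S famA) numulA.
by rewrite T_tail_S_tail (kp2rS famA).
Qed.

Lemma tail_formT b : tail_form (T b).
Proof.
exists (src b), (kpT R (lam b)), (rng b).
have [h [h' e]] := tail_comp_exists b.
rewrite fT (kp2T famA h') -e -(kp2T famA) -numulA.
by rewrite T_tail_S_tail (kp2Tr famA).
Qed.

(** Matrix multiplication: the inner tails collapse to a vertex projection, or to 0 when their
    vertices differ. *)
Lemma tail_form_mul a a' : tail_form a -> tail_form a' -> tail_form (a ** a').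
Proof.
move=> [w [x [w1 ->]]] [w2 [y [w3 ->]]].
exists w, (if w1 == w2 then x ** kpP R (vtx w1) ** y else 0), w3.
rewrite !numulA -(numulA _ (S _) (T _)) S_tail_T_tail.
case: eqP => [_|_]; last by rewrite iota_hom0 !numul0 !nu0mul.
by rewrite !fM fP !numulA.
Qed.

Lemma tail_form_span a : add_span tail_form a.
Proof.
elim/(@KP_ind): a => [w|b|b||a a' ha ha'|a ha|r a ha|a a' ha ha'].
- exact/span_gen/tail_formP.
- exact/span_gen/tail_formS.
- exact/span_gen/tail_formT.
- exact: span0.
- exact: spanD.
- exact: spanN.
- elim: ha => [_ [w [x [w' ->]]]||x y _ hx _ hy|x _ hx].
  + apply: span_gen; exists w, (r *: x), w'.
    by rewrite iota_homZ -nuscaleAr -nuscaleAl.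
  + by rewrite scaler0; apply: span0.
  + by rewrite scalerDr; apply: spanD.
  + by rewrite scalerN; apply: spanN.
- elim: ha => [x hx||x y _ hx _ hy|x _ hx].
  + elim: ha' => [y hy||y z _ hy _ hz|y _ hy].
    * by apply: span_gen; apply: tail_form_mul.
    * by rewrite numul0; apply: span0.
    * by rewrite numulDr; apply: spanD.
    * by rewrite numulN; apply: spanN.
  + by rewrite nu0mul; apply: span0.
  + by rewrite numulDl; apply: spanD.
  + by rewrite nuNmul; apply: spanN.
Qed.

Lemma iota_full a : add_span (fun z => exists a1 x a2, z = a1 ** f x ** a2) a.
Proof.
elim: (tail_form_span a) => [_ [w [x [w' ->]]]|||]; last by move=> *; apply: spanN.
- by apply: span_gen; exists (T (tail w)), x, (S (tail w')).
- exact: span0.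
- by move=> *; apply: spanD.
Qed.

(** A local unit makes [f x] end in projections [P (iota_vert lc v)]. Such a projection kills
    [T (tail w)] unless [w] is that vertex, and then the tail is an identity. *)
Lemma iota_T_tail x w : exists y, f x ** T (tail w) = f y.
Proof.
have [s [_ e]] := KP_local_unit x.
rewrite -e numul_sumr (big_morph f iota_homD iota_hom0) numul_suml.
apply: iota_image_sum => v; rewrite fM fP -numulA.
have -> : T (tail w) = P w ** T (tail w) by rewrite -{2}(src_tail w) (kp2sT famA).
rewrite (numulA (P _)) (kp1 famA); case: eqP => [<-|_]; last first.
  by exists 0; rewrite nu0mul numul0 iota_hom0.
by exists (x ** kpP R v); rewrite tail_iota (kp_T_id famA) (kp1 famA) eqxx fM fP.
Qed.

Lemma S_tail_iota x w : exists y, S (tail w) ** f x = f y.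
Proof.
have [s [e _]] := KP_local_unit x.
rewrite -e numul_suml (big_morph f iota_homD iota_hom0) numul_sumr.
apply: iota_image_sum => v; rewrite fM fP numulA.
have -> : S (tail w) = S (tail w) ** P w by rewrite -{3}(src_tail w) (kp2Ss famA).
rewrite -(numulA (S _)) (kp1 famA); case: eqP => [->|_]; last first.
  by exists 0; rewrite numul0 nu0mul iota_hom0.
by exists (kpP R v ** x); rewrite tail_iota (kp_S_id famA) (kp1 famA) eqxx fM fP.
Qed.

(** On a tail form, the outer tails are absorbed into [f x] and [f y]. *)
Lemma iota_corner x a y : exists z, f x ** a ** f y = f z.
Proof.
elim: (tail_form_span a) => [_ [w [z [w' ->]]]||b c _ [z e] _ [z' e']|b _ [z e]].
- have [x' ex] := iota_T_tail x w; have [y' ey] := S_tail_iota y w'.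
  by exists (x' ** z ** y'); rewrite !fM -ex -ey !numulA.
- by exists 0; rewrite numul0 nu0mul iota_hom0.
- by exists (z + z'); rewrite numulDr numulDl e e' iota_homD.
- by exists (- z); rewrite numulN nuNmul e iota_homN.
Qed.

End IotaHom.

End Corner.

(** * Injectivity *)

Section Injectivity.
Variables (R : comPzRingType) (k : nat) (G : kgraph k).
Hypothesis lc : locally_convex G.
Local Notation D := (desourcification lc).
Local Notation vtx w := (@vinv k G w).1.
Local Notation vov w := (@vinv k G w).2.
Local Notation lam b := (@pinv k G b).1.1.
Local Notation A := (KP R D).
Local Notation B := (KP R G).
Implicit Types (g h : kvert D -> B).

Let famB := KP_family_KP R G.

(* The finitely supported matrices over the vertices of the desourcification
   with [(w, w')] entry in [p_(vtx w) B p_(vtx w')] form an algebra containing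
   a Kumjian-Pask family of the desourcification; this is its action on column
   vectors. *)
Fixpoint act (a : kp_term R D) (g : kvert D -> B) : kvert D -> B :=
  match a with
  | KpP w => fun u => if u == w then kpP R (vtx w) ** g w else 0
  | KpS b => fun u => if u == rng b then kpS R (lam b) ** g (src b) else 0
  | KpT b => fun u => if u == src b then kpT R (lam b) ** g (rng b) else 0
  | Kp0 => fun=> 0
  | KpAdd a b => fun u => act a g u + act b g u
  | KpOpp a => fun u => - act a g u
  | KpScale r a => fun u => r *: act a g u
  | KpMul a b => act a (act b g)
  end.

Lemma actP w g u : act (KpP R w) g u = if u == w then kpP R (vtx w) ** g w else 0.
Proof. by []. Qed.
Lemma actS b g u :
  act (KpS R b) g u = if u == rng b then kpS R (lam b) ** g (src b) else 0.
Proof. by []. Qed.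
Lemma actT b g u :
  act (KpT R b) g u = if u == src b then kpT R (lam b) ** g (rng b) else 0.
Proof. by []. Qed.
Lemma act0 g u : act (Kp0 R D) g u = 0. Proof. by []. Qed.
Lemma actA a b g u : act (KpAdd a b) g u = act a g u + act b g u.
Proof. by []. Qed.
Lemma actN a g u : act (KpOpp a) g u = - act a g u. Proof. by []. Qed.
Lemma actC r a g u : act (KpScale r a) g u = r *: act a g u. Proof. by []. Qed.
Lemma actM a b g u : act (KpMul a b) g u = act a (act b g) u. Proof. by []. Qed.
Definition actE := (actP, actS, actT, act0, actA, actN, actC, actM).

Lemma actD a g h u : act a (fun v => g v + h v) u = act a g u + act a h u.
Proof.
elim: a g h u => /= [w|b|b||a IHa b IHb|a IHa|r a IHa|a IHa b IHb] g h u.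
- by case: eqP; rewrite ?numulDr ?addr0.
- by case: eqP; rewrite ?numulDr ?addr0.
- by case: eqP; rewrite ?numulDr ?addr0.
- by rewrite addr0.
- by rewrite IHa IHb addrACA.
- by rewrite IHa opprD.
- by rewrite IHa scalerDr.
- by rewrite -IHa; congr act; apply/funext => v.
Qed.

Lemma actZ a r g u : act a (fun v => r *: g v) u = r *: act a g u.
Proof.
elim: a g u => /= [w|b|b||a IHa b IHb|a IHa|s a IHa|a IHa b IHb] g u.
- by case: eqP; rewrite ?scaler0 // nuscaleAr.
- by case: eqP; rewrite ?scaler0 // nuscaleAr.
- by case: eqP; rewrite ?scaler0 // nuscaleAr.
- by rewrite scaler0.
- by rewrite IHa IHb scalerDr.
- by rewrite IHa scalerN.
- by rewrite IHa !scalerA mulrC.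
- by rewrite -IHa; congr act; apply/funext => v.
Qed.

Lemma lam_comp (b c : kpath D) (e : src b = rng c) :
  exists h : src (lam b) = rng (lam c), lam (kcomp e) = kcomp h.
Proof. by have [h ->] := pinv_comp e erefl erefl; exists h. Qed.

Lemma lam_idp (w : kvert D) : lam (idp w) = idp (vtx w).
Proof. by rewrite pinv_idp. Qed.

Lemma rng_lam (b : kpath D) : rng (lam b) = vtx (rng b).
Proof. by rewrite vinv_rng. Qed.

Lemma src_lam (b : kpath D) : src (lam b) = vtx (src b).
Proof. by rewrite vinv_src. Qed.

(** The relations of the desourcification, read through [lam], become relations in the algebra of
    [G]; hence the action descends to classes. *)
Lemma act_eq a b : kp_eq a b -> act a = act b.
Proof.
move=> ab; apply/funext => g; apply/funext => u; elim: ab g u => {a b}.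
- by [].
- by move=> a b _ IH g u; rewrite IH.
- by move=> a b c _ IH1 _ IH2 g u; rewrite IH1 IH2.
- by move=> a a' b b' _ IHa _ IHb g u; rewrite !actE IHa IHb.
- by move=> a a' _ IHa g u; rewrite !actE IHa.
- by move=> r a a' _ IHa g u; rewrite !actE IHa.
- move=> a a' b b' _ IHa _ IHb g u; rewrite !actE IHa.
  by congr act; apply/funext => v; rewrite IHb.
- by move=> a b c g u; rewrite !actE addrA.
- by move=> a b g u; rewrite !actE addrC.
- by move=> a g u; rewrite !actE add0r.
- by move=> a g u; rewrite !actE addNr.
- by move=> r s a g u; rewrite !actE scalerA.
- by move=> a g u; rewrite !actE scale1r.
- by move=> r a b g u; rewrite !actE scalerDr.
- by move=> r s a g u; rewrite !actE scalerDl.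
- by [].
- by [].
- by move=> a b c g u; rewrite !actE -actD.
- by move=> r a b g u; rewrite !actE.
- by move=> r a b g u; rewrite !actE -actZ.
- by move=> w g u; rewrite !actE rng_id src_id lam_idp (kp_S_id famB).
- by move=> w g u; rewrite !actE rng_id src_id lam_idp (kp_T_id famB).
- move=> v w g u; rewrite !actE; case: (eqVneq v w) => [<-|vw].
    by rewrite actP numulA (kp1 famB) eqxx.
  by rewrite act0 numul0 if_same.
- move=> l m e g u; have [h eh] := lam_comp e.
  by rewrite !actE eh rng_comp src_comp e eqxx numulA (kp2S famB h).
- move=> l m e g u; have [h eh] := lam_comp e.
  by rewrite !actE eh rng_comp src_comp e eqxx numulA (kp2T famB h).
- by move=> l g u; rewrite !actE eqxx numulA -rng_lam (kp2rS famB).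
- by move=> l g u; rewrite !actE eqxx numulA -src_lam (kp2Ss famB).
- by move=> l g u; rewrite !actE eqxx numulA -src_lam (kp2sT famB).
- by move=> l g u; rewrite !actE eqxx numulA -rng_lam (kp2Tr famB).
(* Different ranges give 0 by support; with equal ranges, distinct [l] and [m] have distinct images
   under [lam], and [kp3] for [G] applies. *)
- move=> n l m n0 bl bm g u; rewrite !actE.
  have [dl dm] : (pinv l).2 = n /\ (pinv m).2 = n.
    by split; apply/bounded_paths_desourcification.
  have [bl' bm'] : bounded_paths n (lam l) /\ bounded_paths n (lam m).
    by split; [rewrite -dl|rewrite -dm]; apply: dpath_bounded.
  case: (eqVneq l m) => [<-|lm].
    by rewrite actP eqxx numulA (kp3 famB n0 bl' bl') eqxx src_lam.
  rewrite act0; case: (eqVneq (rng l) (rng m)) => [rlm|_]; last by rewrite numul0 if_same.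
  rewrite numulA (kp3 famB n0 bl' bm'); case: (eqVneq (lam l) (lam m)) => [e|_].
    by case/eqP: lm; apply: lam_inj => //; rewrite -!pinv_deg dl dm.
  by rewrite nu0mul if_same.
(* [desourcification_enum] turns this into [kp4] for [G] at [vtx v]. *)
- move=> v n s n0 us hs g u.
  have [us' hs'] := desourcification_enum us hs.
  have rs l : l \in s -> rng l = v by move=> /hs[].
  rewrite actP (kp4 famB n0 us' hs') big_map.
  have -> : act (foldr (fun l => KpAdd (KpMul (KpS R l) (KpT R l))) (Kp0 R D) s) g u =
      \sum_(l <- s) if u == rng l then kpS R (lam l) ** kpT R (lam l) ** g (rng l) else 0.
    elim: s {us hs us' hs' rs} => [|l s IHs]; first by rewrite big_nil.
    by rewrite big_cons -IHs actA !actE eqxx numulA.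
  transitivity (\sum_(l <- s)
      if u == v then kpS R (lam l) ** kpT R (lam l) ** g v else 0).
    by case: (u == v); [rewrite numul_suml|rewrite big1].
  by apply: eq_big_seq => l /rs ->.
Qed.

(** The induced homomorphism on terms, the level at which [act] is defined. *)
Fixpoint iota_term (a : kp_term R G) : kp_term R D :=
  match a with
  | KpP v => KpP R (iota_vert lc v)
  | KpS l => KpS R (iota_path lc l)
  | KpT l => KpT R (iota_path lc l)
  | Kp0 => Kp0 R D
  | KpAdd a b => KpAdd (iota_term a) (iota_term b)
  | KpOpp a => KpOpp (iota_term a)
  | KpScale r a => KpScale r (iota_term a)
  | KpMul a b => KpMul (iota_term a) (iota_term b)
  end.

Lemma kp_class_iota a : kp_class (iota_term a) =
  kp_eval (fun v => kpP R (iota_vert lc v)) (fun l => kpS R (iota_path lc l))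
    (fun l => kpT R (iota_path lc l)) a.
Proof.
elim: a => //= [a <- b <-|a <-|r a <-|a <- b <-].
- by rewrite -kp_addE.
- by rewrite -kp_oppE.
- by rewrite -kp_scaleE.
- by rewrite -kp_mulE.
Qed.

(** The vertices with [vov w == 0] are those of the form [iota_vert lc v]; the column spreads [x]
    over them as [kpP R v ** x]. *)
Definition iota_column (x : B) (w : kvert D) : B :=
  if vov w == 0 then kpP R (vtx w) ** x else 0.

Lemma iota_columnP (x : B) v : iota_column x (iota_vert lc v) = kpP R v ** x.
Proof. by rewrite /iota_column vinv_iota eqxx. Qed.

Lemma act_iota_column a x :
  act (iota_term a) (iota_column x) = iota_column (kp_class a ** x).
Proof.
(* If [kpP R v] fixes [y], orthogonality of the vertex projections kills every other entry of its
   column. *)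
have K v y : kpP R v ** y = y -> (fun w => if w == iota_vert lc v then y else 0) =
    iota_column y.
  move=> yv; apply/funext => w; case: eqP => [->|ne].
    by rewrite iota_columnP yv.
  rewrite /iota_column; case: eqP => // o; rewrite -yv numulA (kp1 famB).
  case: eqP => [e|_]; last by rewrite nu0mul.
  by case: ne; apply: vinv_inj; rewrite vinv_iota [LHS]surjective_pairing e o.
elim: a x => [v|l|l||a IHa b IHb|a IHa|r a IHa|a IHa b IHb] x; cbn [iota_term].
- rewrite -(K v (kpP R v ** x)) ?numulA ?(kp1 famB) ?eqxx //; apply/funext => w.
  by rewrite actE vinv_iota iota_columnP numulA (kp1 famB) eqxx.
- rewrite -(K (rng l) (kpS R l ** x)) ?numulA ?(kp2rS famB) //; apply/funext => w.
  by rewrite actE rng_iota src_iota lam_iota iota_columnP numulA (kp2Ss famB).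
- rewrite -(K (src l) (kpT R l ** x)) ?numulA ?(kp2sT famB) //; apply/funext => w.
  by rewrite actE rng_iota src_iota lam_iota iota_columnP numulA (kp2Tr famB).
- by apply/funext => w; rewrite /iota_column [kp_class _ ** x]nu0mul numul0 if_same.
- apply/funext => w; rewrite actE IHa IHb -kp_addE [kp_add _ _ ** x]numulDl.
  by rewrite /iota_column; case: eqP; rewrite ?addr0 // numulDr.
- apply/funext => w; rewrite actE IHa -kp_oppE [kp_opp _ ** x]nuNmul.
  by rewrite /iota_column; case: eqP; rewrite ?oppr0 // numulN.
- apply/funext => w; rewrite actE IHa -kp_scaleE -[kp_scale _ _ ** x]nuscaleAl.
  by rewrite /iota_column; case: eqP; rewrite ?scaler0 // -nuscaleAr.
- by apply/funext => w; rewrite actE IHb IHa -kp_mulE -[kp_mul _ _ ** x]numulA.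
Qed.

(** Equal images give congruent terms, hence the same action on [iota_column z]; comparing entries
    gives [kpP R v ** (x ** z)] equal to [kpP R v ** (y ** z)]. *)
Lemma iota_hom_inj : injective (kp_lift (fun v => kpP R (iota_vert lc v))
  (fun l => kpS R (iota_path lc l)) (fun l => kpT R (iota_path lc l)) : B -> A).
Proof.
move=> x y; rewrite /kp_lift -!kp_class_iota => /kp_classP/act_eq e.
apply: KP_eq_of_products => v z; rewrite -!iota_columnP.
by rewrite -(kp_reprK x) -(kp_reprK y) -!act_iota_column e.
Qed.

End Injectivity.

(** * The Morita context between the two algebras *)

Theorem corollary7p5 (k : nat) (hk : (0 < k)%N) (L : kgraph k)
    (lc : locally_convex L) (rf : row_finite L) (R : comPzRingType) :
  exists X : morita_context (KP R (desourcification lc)) (KP R L),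
    surjective_morita X.
Proof.
have fam := iota_family R lc.
pose f := kp_lift (fun v => kpP R (iota_vert lc v))
  (fun l => kpS R (iota_path lc l)) (fun l => kpT R (iota_path lc l)).
have fP v : f (kpP R v) = kpP R (iota_vert lc v) by rewrite [LHS](kp_liftE fam).
have fS l : f (kpS R l) = kpS R (iota_path lc l) by rewrite [LHS](kp_liftE fam).
have fT l : f (kpT R l) = kpT R (iota_path lc l) by rewrite [LHS](kp_liftE fam).
have flin : linear f.
  move=> r x y; rewrite -(kp_reprK x) -(kp_reprK y).
  by rewrite [_ *: _]kp_scaleE [_ + _]kp_addE /f !(kp_liftE fam).
have fM : {morph f : x y / x ** y}.
  by move=> x y; rewrite -(kp_reprK x) -(kp_reprK y) [_ ** _]kp_mulE /f !(kp_liftE fam).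
apply: (morita_of_full_corner (f := f)).
- exact: iota_homD.
- exact: fM.
- exact: iota_hom_inj.
- exact: iota_corner.
- exact: iota_full.
- exact: KP_idempotent.
Qed.
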